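(* For any FDZ-scalar ring $A$ there exists a sentence $\psi_A$ of $L_1$ such that $A\models\psi_A$ and for every FDZ-scalar ring $B$, $$B\models\psi_A\iff A\cong B.$$
   Context: A scalar ring is a commutative associative ring with unit. An FDZ-scalar ring is a scalar ring whose additive group is finitely generated as an abelian group. $L_1$ is the usual first-order language of rings with identity, with signature $\langle +,\cdot,0,1\rangle$. *)

(* Defs.v *)
From HB Require Import structures.
From mathcomp Require Import all_boot all_order all_algebra.

Set Implicit Arguments.
Unset Strict Implicit.
Unset Printing Implicit Defensive.

Import GRing.Theory.
Local Open Scope ring_scope.

(* First-order syntax over the signature <+, *, 0, 1>. [GRing.term] and
   [GRing.formula] are not used: they have a constant for every element of the
   ring, as well as opposite, inverse and a unit predicate. *)
Inductive L1_term : Type :=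
| TVar of nat
| TZero
| TOne
| TAdd of L1_term & L1_term
| TMul of L1_term & L1_term.

Inductive L1_formula : Type :=
| FEq of L1_term & L1_term
| FNot of L1_formula
| FAnd of L1_formula & L1_formula
| FOr of L1_formula & L1_formula
| FImp of L1_formula & L1_formula
| FAll of nat & L1_formula
| FEx of nat & L1_formula.

Fixpoint term_vars (t : L1_term) : seq nat :=
  match t with
  | TVar i => [:: i]
  | TZero | TOne => [::]
  | TAdd t1 t2 | TMul t1 t2 => term_vars t1 ++ term_vars t2
  end.

Fixpoint free_vars (phi : L1_formula) : seq nat :=
  match phi with
  | FEq t1 t2 => term_vars t1 ++ term_vars t2
  | FNot p => free_vars p
  | FAnd p q | FOr p q | FImp p q => free_vars p ++ free_vars q
  | FAll i p | FEx i p => [seq j <- free_vars p | j != i]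
  end.

Definition L1_sentence (phi : L1_formula) : Prop := free_vars phi = [::].

Fixpoint term_eval (R : pzRingType) (e : nat -> R) (t : L1_term) : R :=
  match t with
  | TVar i => e i
  | TZero => 0
  | TOne => 1
  | TAdd t1 t2 => term_eval e t1 + term_eval e t2
  | TMul t1 t2 => term_eval e t1 * term_eval e t2
  end.

Fixpoint L1_holds (R : pzRingType) (e : nat -> R) (phi : L1_formula) : Prop :=
  match phi with
  | FEq t1 t2 => term_eval e t1 = term_eval e t2
  | FNot p => ~ L1_holds e p
  | FAnd p q => L1_holds e p /\ L1_holds e q
  | FOr p q => L1_holds e p \/ L1_holds e q
  | FImp p q => L1_holds e p -> L1_holds e q
  | FAll i p => forall x : R, L1_holds [eta e with i |-> x] p
  | FEx i p => exists x : R, L1_holds [eta e with i |-> x] p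
  end.

(* For a sentence the valuation is irrelevant, see [models_sentence]. *)
Definition models (R : pzRingType) (phi : L1_formula) : Prop :=
  forall e : nat -> R, L1_holds e phi.

Lemma term_eval_eq (R : pzRingType) (e e' : nat -> R) (t : L1_term) :
  {in term_vars t, e =1 e'} -> term_eval e t = term_eval e' t.
Proof.
elim: t => [i|||t1 IH1 t2 IH2|t1 IH1 t2 IH2] //= H; first by apply: H; rewrite inE.
all: by rewrite IH1 ?IH2 // => i Hi; apply: H; rewrite mem_cat Hi ?orbT.
Qed.

Lemma L1_holds_eq (R : pzRingType) (phi : L1_formula) (e e' : nat -> R) :
  {in free_vars phi, e =1 e'} -> L1_holds e phi <-> L1_holds e' phi.
Proof.
have sub (s1 s2 : seq nat) (f f' : nat -> R) : {in s1 ++ s2, f =1 f'} ->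
    {in s1, f =1 f'} /\ {in s2, f =1 f'}.
  by move=> H; split=> i Hi; apply: H; rewrite mem_cat Hi ?orbT.
have upd (i : nat) (p : L1_formula) (f f' : nat -> R) (x : R) :
    {in [seq j <- free_vars p | j != i], f =1 f'} ->
    {in free_vars p, [eta f with i |-> x] =1 [eta f' with i |-> x]}.
  by move=> H j Hj /=; case: eqVneq => // ne; apply: H; rewrite mem_filter ne.
elim: phi e e' => [t1 t2|p IHp|p IHp q IHq|p IHp q IHq|p IHp q IHq|i p IHp|i p IHp]
  e e' /= H.
- by have [H1 H2] := sub _ _ _ _ H; rewrite (term_eval_eq H1) (term_eval_eq H2).
- by have := IHp _ _ H; tauto.
- by have [/IHp H1 /IHq H2] := sub _ _ _ _ H; tauto.
- by have [/IHp H1 /IHq H2] := sub _ _ _ _ H; tauto.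
- by have [/IHp H1 /IHq H2] := sub _ _ _ _ H; tauto.
- by split=> Hx x; apply/(IHp _ _ (upd i p e e' x H)).
- by split=> -[x Hx]; exists x; apply/(IHp _ _ (upd i p e e' x H)).
Qed.

Lemma models_sentence (R : pzRingType) (phi : L1_formula) (e : nat -> R) :
  L1_sentence phi -> models R phi <-> L1_holds e phi.
Proof.
move=> phi0; split=> [|He e']; first exact.
have [|_ H] := @L1_holds_eq R phi e' e; last exact: H.
by rewrite phi0.
Qed.

Definition FDZ (R : pzRingType) : Prop :=
  exists (n : nat) (s : n.-tuple R), forall x : R, inIntSpan s x.

Definition ring_iso (R S : pzRingType) : Prop :=
  exists f : {rmorphism R -> S}, bijective f.

(* Main.v *)
From HB Require Import structures.
Require Import Defs.
From mathcomp Require Import all_boot all_order all_algebra.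
From mathcomp Require Import boolp.
From mathcomp Require Import zify ring.

(** Why the theorem is true. Fix [A], a commutative ring whose additive group is
    finitely generated. Since [A] is finitely presented, a sentence can assert
    that there is a morphism [f] from [A] to [B] and go on to speak of the
    elements [f a] of [B] (lemmas [finite_presentation], [sentence_of_def]).
    It remains to write a first-order condition on [f] which holds for the
    identity of [A] and which, when the additive group of [B] is finitely
    generated, forces [f] to be bijective.

    Choose a filtration of [A] by ideals, each obtained from the previous one
    [I] by adding one element [b] whose annihilator [P] modulo [I] is prime
    ([prime_filtration]). The images of these elements under [f] give a
    filtration of [B], with successive quotients [B / P'], where [P'] is the
    annihilator of [f b] modulo the corresponding ideal of [B]. Climbing the
    two filtrations, [f] is bijective as soon as, at each step, every element
    of [B] is congruent to some [f a] modulo [P'] and [f c] belongs to [P'] only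
    if [c] belongs to [P] ([controlled_bijective]). Everything here is
    first-order except for the congruence to some [f a].

    If [A / P] is finite, a finite list of candidates for [a] is enough
    ([finite_step]). Otherwise [A / P] is a domain of characteristic zero,
    and one wants to say that every element of [B] is congruent modulo [P'] to a
    combination of the [f s] with natural coefficients, where [s] runs through
    generators of [A]. Such a statement is available because the natural
    numbers are definable in the domain [B / P'] ([nat_modP],
    [infinite_step]), uniformly in all such domains for which the number of
    elements modulo [2] is bounded by a given number. The definition is in
    the style of Julia Robinson: there is a definable family of sets, all of them
    finite, among which are all the initial segments of the natural numbers;
    and [x] is a natural number when some member of the family contains [0]
    and contains [t + 1] whenever it contains [t], unless [t] is [x].

    Finiteness is obtained with norms. The domain has a finite basis over the
    integers, of rank [r]. If each of [t + 1], ..., [t + N + 1] divides [f],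
    with [f] nonzero and [r <= N], the norms of these elements divide that of
    [f]. Hence the characteristic polynomial of [- t], of degree [r], takes at
    [r + 1] given integers values among finitely many: there are finitely many
    such polynomials, and finitely many such [t] ([shifted_divisors_finite]).
    An initial segment is then cut out of such a finite set by a comaximality
    condition, as with the beta function of arithmetic. *)

Set Implicit Arguments.
Unset Strict Implicit.
Unset Printing Implicit Defensive.

Import Order.TTheory GRing.Theory Num.Theory.
Local Open Scope ring_scope.

(** * Finitely generated abelian groups *)

Definition subgroup (V : zmodType) (H : V -> Prop) : Prop :=
  H 0 /\ forall x y, H x -> H y -> H (x - y).

Fixpoint zspan (V : zmodType) (s : seq V) (x : V) : Prop :=
  if s is a :: s' then exists z : int, zspan s' (x - a *~ z) else x = 0.

Section Subgroups.
Variable V : zmodType.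
Implicit Types (H : V -> Prop) (s : seq V).

Lemma subgroupN H x : subgroup H -> H x -> H (- x).
Proof. by case=> H0 HB Hx; rewrite -sub0r; apply: HB. Qed.

Lemma subgroupD H x y : subgroup H -> H x -> H y -> H (x + y).
Proof.
by move=> sH Hx Hy; rewrite -[y]opprK; apply: sH.2 => //; apply: subgroupN.
Qed.

Lemma subgroupMz H x (z : int) : subgroup H -> H x -> H (x *~ z).
Proof.
move=> sH Hx; have HMn n : H (x *+ n).
  by elim: n => [|n IH]; [rewrite mulr0n; apply: sH.1 | rewrite mulrS; apply: subgroupD].
by case: z => n; rewrite ?NegzE ?mulrNz; [exact: HMn | apply: subgroupN (HMn n.+1)].
Qed.

Lemma zspan_subgroup s : subgroup (zspan s).
Proof.
elim: s => [|a s [IH0 IHB]] /=; first by split=> // x y -> ->; rewrite subr0.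
split=> [|x y [z Hz] [z' Hz']]; first by exists 0; rewrite subr0.
exists (z - z'); rewrite mulrzBr (_ : _ - _ = x - a *~ z - (y - a *~ z')).
  exact: IHB.
by rewrite !opprB addrACA [RHS]addrACA; congr (_ + _); rewrite addrC.
Qed.

Lemma zspan_mem s x : x \in s -> zspan s x.
Proof.
elim: s => //= a s IH; rewrite inE => /orP[/eqP->|/IH xs].
  by exists 1; rewrite subrr; apply: (zspan_subgroup s).1.
by exists 0; rewrite subr0.
Qed.

Lemma zspan_sub H s : subgroup H -> (forall x, x \in s -> H x) ->
  forall x, zspan s x -> H x.
Proof.
move=> sH; elim: s => [|a s IH] sub x /=; first by move=> ->; apply: sH.1.
case=> z xs; rewrite -(subrK (a *~ z) x); apply: subgroupD => //.
  by apply: IH xs => y ys; apply: sub; rewrite inE ys orbT.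
by apply: subgroupMz => //; apply: sub; rewrite mem_head.
Qed.

(** Peel off one generator [a] at a time: the coefficients at [a] of the
    elements of [H] form an ideal of the integers, and a lift of its least
    positive element, together with generators of the elements of [H] that do
    not involve [a], generates [H]. *)
Lemma subgroup_fg s H : subgroup H -> (forall x, H x -> zspan s x) ->
  exists t : seq V, (forall x, x \in t -> H x) /\ (forall x, H x -> zspan t x).
Proof.
elim: s H => [|a s IH] H sH Hs; first by exists [::].
have sS := zspan_subgroup s.
have [||t [tH Ht]] := IH (fun x => H x /\ zspan s x); last first.
- have [[c [c0 [y [Hy ys]]]]|noc] := pselect (exists c : nat,
    (0 < c)%N /\ exists y, H y /\ zspan s (y - a *+ c)); last first.
    exists t; split=> [x /tH[]//|x Hx]; apply: Ht; split=> //.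
    have /= [z xz] := Hs _ Hx.
    have z0 : z = 0.
      case: z xz => [[|n]|n] xz //; case: noc; exists n.+1; split=> //.
        by exists x.
      exists (- x); split; first exact: subgroupN.
      rewrite -[X in zspan _ X]opprK; apply: subgroupN => //.
      by rewrite opprB opprK addrC; rewrite NegzE mulrNz opprK in xz.
    by move: xz; rewrite z0 subr0.
  have exc : exists c : nat, `[< (0 < c)%N /\ exists y, H y /\ zspan s (y - a *+ c) >].
    by exists c; apply/asboolP; split=> //; exists y.
  have [{c c0 Hy ys exc}c /asboolP[c0 [{}y [Hy ys]]] cmin] := ex_minnP exc.
  exists (y :: t); split=> [x|x Hx].
    by rewrite inE => /orP[/eqP->//|/tH[]].
  have /= [z xz] := Hs _ Hx.
  exists (z %/ c)%Z; apply: Ht.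
  have Hq : H (x - y *~ (z %/ c)%Z) by apply: sH.2 => //; apply: subgroupMz.
  have xq : zspan s (x - y *~ (z %/ c)%Z - a *~ (z %% c)%Z).
    rewrite (_ : _ - _ - _ = x - a *~ z - (y - a *+ c) *~ (z %/ c)%Z).
      by apply: sS.2 => //; apply: subgroupMz.
    have -> : a *~ z = a *~ ((z %/ c)%Z * c) + a *~ (z %% c)%Z.
      by rewrite -mulrzDr -divz_eq.
    rewrite mulrzBl -[a *+ c]/(a *~ c%:Z) -mulrzA [c%:Z * _]mulrC.
    by rewrite !opprD !opprK !addrA [RHS](ACl (1*4*3*5*2)%AC) /= addrK.
  have cZ : (0 : int) < c by [].
  split=> //; case: (z %% c)%Z (modz_ge0 z (lt0r_neq0 cZ)) (ltz_pmod z cZ) xq => // -[|n] _.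
    by rewrite subr0.
  rewrite ltz_nat => nc xq; suff : (c <= n.+1)%N by rewrite leqNgt nc.
  by apply: cmin; apply/asboolP; split=> //; eexists; split; [exact: Hq|].
- by move=> x [].
- split=> [|x y [Hx xs] [Hy ys]]; first by split; [apply: sH.1 | apply: sS.1].
  by split; [apply: sH.2 | apply: sS.2].
Qed.

(** An infinite strictly ascending sequence would have a finitely generated
    union, which would be reached at a finite stage. *)
Lemma maximal_subgroup s (T : Type) (H : T -> V -> Prop) (t0 : T) :
  (forall x, zspan s x) -> (forall t, subgroup (H t)) ->
  exists t, forall t', (forall x, H t x -> H t' x) -> forall x, H t' x -> H t x.
Proof.
move=> allV sH; apply: contrapT => nomax.
have next t : exists t', (forall x, H t x -> H t' x) /\ ~ (forall x, H t' x -> H t x).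
  apply: contrapT => not_next; apply: nomax; exists t => t' tt'.
  by apply: contrapT => notsub; apply: not_next; exists t'.
have {next}[nx nxP] := choice next.
pose K k := H (iter k nx t0).
have Kmono k l x : (k <= l)%N -> K k x -> K l x.
  move=> /subnK<-; elim: (l - k)%N => // m IH /IH.
  exact: (nxP (iter (m + k) nx t0)).1.
have [|x _|t [tK Kt]] := @subgroup_fg s (fun x => exists k, K k x); last 1 first.
- have [k tk] : exists k, forall x, x \in t -> K k x.
    elim: t tK {Kt} => [|a t IH] tK; first by exists 0%N.
    have [|k tk] := IH; first by move=> x xt; apply: tK; rewrite inE xt orbT.
    have [l al] := tK a (mem_head _ _).
    exists (maxn k l) => x; rewrite inE => /orP[/eqP->|/tk xk].
      by apply: Kmono al; apply: leq_maxr.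
    by apply: Kmono xk; apply: leq_maxl.
  apply: (nxP (iter k nx t0)).2 => x Hx.
  apply: (zspan_sub (sH (iter k nx t0)) tk); apply: Kt.
  by exists k.+1.
- split=> [|x y [k Hx] [l Hy]]; first by exists 0%N; apply: (sH _).1.
  exists (maxn k l); apply: (sH _).2; [apply: Kmono Hx | apply: Kmono Hy].
    exact: leq_maxl.
  exact: leq_maxr.
- exact: allV.
Qed.
End Subgroups.

(** * Filtrations with prime annihilators *)

Definition is_ideal (R : pzRingType) (P : R -> Prop) : Prop :=
  subgroup P /\ forall a x, P x -> P (a * x).

Definition prime_ideal (R : pzRingType) (P : R -> Prop) : Prop :=
  [/\ is_ideal P, ~ P 1 & forall x y, P (x * y) -> P x \/ P y].

Fixpoint ideal_gen (R : pzRingType) (bs : seq R) (y : R) : Prop :=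
  if bs is b :: bs' then exists c y', ideal_gen bs' y' /\ y = c * b + y'
  else y = 0.

Definition colon (R : pzRingType) (bs : seq R) (b y : R) : Prop :=
  ideal_gen bs (y * b).

(** The head of the list is the last element added, so that [bs'] generates the
    ideal to which [b] is added. *)
Fixpoint prime_chain (R : pzRingType) (bs : seq R) : Prop :=
  if bs is b :: bs' then prime_ideal (colon bs' b) /\ prime_chain bs' else True.

Section Filtration.
Variable R : comPzRingType.
Implicit Type bs : seq R.

Lemma ideal_gen_ideal bs : is_ideal (ideal_gen bs).
Proof.
elim: bs => [|b bs [[I0 IB] IM]] /=.
  by split=> [|a x ->]; [split=> // x y -> ->; rewrite subr0 | rewrite mulr0].
split=> [|a x [c [y [Iy ->]]]].
  split=> [|x y [c [x' [Ix ->]]] [d [y' [Iy ->]]]].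
    by exists 0, 0; rewrite mul0r addr0.
  by exists (c - d), (x' - y'); split; [exact: IB | ring].
by exists (a * c), (a * y); split; [exact: IM | ring].
Qed.

Lemma ideal_gen_cons b bs y : ideal_gen bs y -> ideal_gen (b :: bs) y.
Proof. by move=> Iy; exists 0, y; rewrite mul0r add0r. Qed.

Lemma ideal_gen_head b bs : ideal_gen (b :: bs) b.
Proof.
by exists 1, 0; rewrite mul1r addr0; split=> //; case: (ideal_gen_ideal bs) => -[].
Qed.

Lemma colon_ideal bs b : is_ideal (colon bs b).
Proof.
have [[I0 IB] IM] := ideal_gen_ideal bs; rewrite /colon.
split=> [|a x Ix]; last by rewrite -mulrA; apply: IM.
by split=> [|x y Ix Iy]; rewrite ?mul0r // mulrBl; apply: IB.
Qed.

Lemma FDZ_zspan : FDZ R -> exists s : seq R, forall x, zspan s x.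
Proof.
case=> n [s sP]; exists (tval s) => x; have [a ->] := sP x.
have sS := zspan_subgroup (tval s).
elim/big_ind: _ => [|u v|i _]; [exact: sS.1 | exact: subgroupD |].
by apply: subgroupMz => //; apply: zspan_mem; rewrite mem_nth // size_tuple.
Qed.

(** If [y * b] is not in the ideal, its annihilator contains that of [b]; so
    the annihilator of [b] is prime as soon as it is maximal among the
    annihilators of elements outside the ideal. *)
Lemma colon_prime bs : FDZ R -> ~ ideal_gen bs 1 ->
  exists b, prime_ideal (colon bs b).
Proof.
move=> /FDZ_zspan[s sP] I1.
pose T := {b : R | ~ ideal_gen bs b}.
have [|[b Ib] /= bmax] := @maximal_subgroup R s T
  (fun t => colon bs (sval t)) (exist _ 1 I1) sP.
  by move=> [b Ib]; apply: (colon_ideal bs b).1.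
exists b; split=> [||x y]; first exact: colon_ideal.
  by rewrite /colon mul1r.
move=> Ixy; apply: contrapT => /not_orP[nIx nIy]; apply: nIx.
apply: (bmax (exist _ (y * b) nIy)) => /= [z|]; rewrite /colon.
  by move=> Iz; rewrite mulrCA; apply: (ideal_gen_ideal bs).2.
by rewrite mulrA.
Qed.

(** As long as the ideal reached is proper, [colon_prime] extends the chain by an
    element outside this ideal, which cannot go on forever. *)
Lemma prime_filtration : FDZ R -> exists bs : seq R, prime_chain bs /\ ideal_gen bs 1.
Proof.
move=> FR; have [s sP] := FDZ_zspan FR.
pose T := {bs : seq R | prime_chain bs}.
have [|[bs cbs] /= bsmax] := @maximal_subgroup R s T
  (fun t => ideal_gen (sval t)) (exist _ [::] I) sP.
  by move=> [bs cbs]; apply: (ideal_gen_ideal bs).1.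
exists bs; split=> //; apply: contrapT => I1.
have [b Pb] := colon_prime FR I1; have [_ nIb _] := Pb.
apply: nIb; rewrite /colon mul1r.
apply: (bsmax (exist _ (b :: bs) (conj Pb cbs))) => /=.
  exact: ideal_gen_cons.
exact: ideal_gen_head.
Qed.
End Filtration.

(** * The quotient by a prime ideal *)

Section PrimeQuotient.
Variables (R : comPzRingType) (P : R -> Prop) (Pprime : prime_ideal P).

(** An alias of [R] is needed because quotients are formed from rings with
    [1 != 0], a fact which only holds here because [P] is proper. *)
Definition nz_ring_of (_ : prime_ideal P) : Type := R.
Notation nz_ring := (nz_ring_of Pprime).
HB.instance Definition _ := GRing.ComPzRing.on nz_ring.

Fact nz_ring_oner_neq0 : (1 : nz_ring) != 0.
Proof.
have [[[P0 _] _] P1 _] := Pprime.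
by apply/eqP => e; apply: P1; rewrite [1](e : (1 : R) = 0).
Qed.
HB.instance Definition _ :=
  GRing.PzSemiRing_isNonZero.Build nz_ring nz_ring_oner_neq0.

Definition prime_mem (x : nz_ring) : bool := `[< P x >].

Fact prime_mem_ideal : idealr_closed prime_mem.
Proof.
have [[sP PM] P1 _] := Pprime.
split; first exact/asboolP/sP.1; first by apply/asboolP.
move=> a u v /asboolP Pu /asboolP Pv; apply/asboolP.
exact: subgroupD sP (PM _ _ Pu) Pv.
Qed.
HB.instance Definition _ := isIdealr.Build nz_ring prime_mem prime_mem_ideal.

Fact prime_mem_prime : prime_idealr_closed prime_mem.
Proof.
have [_ _ PP] := Pprime.
by move=> u v /asboolP/PP[] uP; apply/orP; [left | right]; apply/asboolP.
Qed.
HB.instance Definition _ := isPrimeIdealrClosed.Build nz_ring prime_mem prime_mem_prime.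

Definition prime_idealr_mem : prime_idealr nz_ring := PrimeIdealr.clone nz_ring prime_mem _.

Definition quot_domain : Type := {ideal_quot prime_idealr_mem}.
HB.instance Definition _ := GRing.ComNzRing.on quot_domain.

Definition quot_unit (x : quot_domain) : bool := `[< exists y, y * x = 1 >].

Fact quot_inv_ex (x : quot_domain) :
  exists y, if quot_unit x then y * x = 1 else y = x.
Proof.
case ux: (quot_unit x); last by exists x.
by have /asboolP[y yx] := ux; exists y.
Qed.

Definition quot_inv (x : quot_domain) : quot_domain := sval (cid (quot_inv_ex x)).

Fact quot_mulVx : {in quot_unit, left_inverse 1 quot_inv *%R}.
Proof.
move=> x ux; rewrite /quot_inv; case: cid => y /=.
by rewrite (_ : quot_unit x = true).
Qed.

Fact quot_unitPl (x y : quot_domain) : y * x = 1 -> quot_unit x.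
Proof. by move=> yx; apply/asboolP; exists y. Qed.

Fact quot_invr_out : {in [predC quot_unit], quot_inv =1 id}.
Proof.
move=> x /negPf ux; rewrite /quot_inv; case: cid => y /=.
by rewrite (_ : quot_unit x = false).
Qed.

HB.instance Definition _ := GRing.ComNzRing_hasMulInverse.Build quot_domain
  quot_mulVx quot_unitPl quot_invr_out.
HB.instance Definition _ := GRing.ComUnitRing_isIntegral.Build quot_domain
  (@Quotient.rquot_IdomainAxiom nz_ring prime_idealr_mem).

Definition quot_pi (x : R) : quot_domain :=
  \pi_({ideal_quot prime_idealr_mem})%qT (x : nz_ring).

Fact quot_pi_zmod : zmod_morphism quot_pi.
Proof. by move=> x y; exact: (raddfB \pi_({ideal_quot prime_idealr_mem})%qT). Qed.
HB.instance Definition _ :=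
  GRing.isZmodMorphism.Build R quot_domain quot_pi quot_pi_zmod.

Fact quot_pi_monoid : monoid_morphism quot_pi.
Proof.
split=> [|x y]; first exact: (rmorph1 \pi_({ideal_quot prime_idealr_mem})%qT).
exact: (rmorphM \pi_({ideal_quot prime_idealr_mem})%qT).
Qed.
HB.instance Definition _ :=
  GRing.isMonoidMorphism.Build R quot_domain quot_pi quot_pi_monoid.

Lemma quot_pi_surj (y : quot_domain) : exists x, quot_pi x = y.
Proof. by exists (repr y); rewrite /quot_pi reprK. Qed.

Lemma quot_pi_eq0 x : quot_pi x = 0 <-> P x.
Proof.
have e : (quot_pi x == quot_pi 0) = prime_mem x.
  by rewrite -[x in RHS]subr0 -[LHS](Quotient.idealrBE prime_idealr_mem).
rewrite raddf0 in e.
by split=> [/eqP|Px]; [rewrite e => /asboolP | apply/eqP; rewrite e; apply/asboolP].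
Qed.

End PrimeQuotient.

Lemma prime_quotient (R : comPzRingType) (P : R -> Prop) : prime_ideal P ->
  exists (D : idomainType) (p : {rmorphism R -> D}),
    (forall y, exists x, p x = y) /\ (forall x, p x = 0 <-> P x).
Proof.
move=> hP; exists (quot_domain hP), (quot_pi hP).
by split; [exact: quot_pi_surj | exact: quot_pi_eq0].
Qed.

(** * Integral matrices acting on a finitely generated domain *)

Definition int_comb (R : pzRingType) n (c : 'rV[int]_n) (b : 'cV[R]_n) : R :=
  \sum_i (c 0 i)%:~R * b i 0.

Definition generates (R : pzRingType) n (b : 'cV[R]_n) : Prop :=
  forall x, exists c, x = int_comb c b.

Lemma zspan_int_comb (R : pzRingType) (s : seq R) (x : R) : zspan s x ->
  exists c, x = int_comb c (\col_(i < size s) s`_i).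
Proof.
elim: s x => [|a s IH] x /=; first by move=> ->; exists 0; rewrite /int_comb big_ord0.
case=> z /IH[c xE]; exists (\row_i oapp (c 0) z (unlift ord0 i)).
rewrite -[LHS](subrK (a *~ z)) xE /int_comb big_ord_recl !mxE unlift_none /= addrC.
by rewrite mulrzl; congr (_ + _); apply: eq_bigr => i _; rewrite !mxE liftK.
Qed.

Lemma int_combE (R : pzRingType) n (c : 'rV[int]_n) (b : 'cV[R]_n) :
  int_comb c b = (map_mx intr c *m b) 0 0.
Proof.
by rewrite mxE; apply: eq_bigr => k _; rewrite mxE.
Qed.

Lemma int_comb_mul (R : pzRingType) m n (c : 'rV[int]_m) (A : 'M[int]_(m, n))
    (b : 'cV[R]_n) :
  int_comb (c *m A) b = int_comb c (map_mx intr A *m b).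
Proof.
by rewrite !int_combE map_mxM mulmxA.
Qed.

(** Cayley-Hamilton: [\det (t - M)] kills every generator. *)
Lemma char_poly_root (R : comNzRingType) n (b : 'cV[R]_n) (M : 'M[int]_n) (t : R) :
  generates b -> t *: b = map_mx intr M *m b ->
  root (map_poly intr (char_poly M)) t.
Proof.
move=> gb tb; rewrite map_char_poly; set A := map_mx _ M in tb *.
have dE : (char_poly A).[t] = \det (t%:M - A).
  rewrite /char_poly -horner_evalE -det_map_mx; congr (\det _).
  by apply/matrixP => i j; rewrite !mxE /= /horner_eval !hornerE hornerMn hornerX.
have db : \det (t%:M - A) *: b = 0.
  rewrite -mul_scalar_mx -mul_adj_mx -mulmxA mulmxBl mul_scalar_mx tb subrr.
  by rewrite mulmx0.
rewrite /root dE; have [c oneE] := gb 1.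
rewrite -[X in X == 0]mulr1 oneE mulr_sumr big1 // => i _.
by rewrite mulrCA; move/matrixP/(_ i 0): db; rewrite !mxE => ->; rewrite mulr0.
Qed.

Lemma mul_matrix (R : comNzRingType) n (b : 'cV[R]_n) (t : R) : generates b ->
  exists M : 'M[int]_n, t *: b = map_mx intr M *m b.
Proof.
move=> gb; have /choice[c cE] i := gb (t * b i 0).
exists (\matrix_(i, j) c i 0 j); apply/matrixP => i j; rewrite !mxE ord1 cE.
by apply: eq_bigr => k _; rewrite !mxE.
Qed.

(** An algebraic integer divides the constant term of an integral equation that
    it satisfies, and this constant can be chosen nonzero. *)
Lemma int_multiple (D : idomainType) n (b : 'cV[D]_n) (x : D) :
  generates b -> x != 0 -> exists a (m : int), x * a = m%:~R /\ m%:~R != 0 :> D.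
Proof.
move=> gb x0; have [M Mx] := mul_matrix x gb.
have := char_poly_root gb Mx; move: (char_poly M) (char_poly_monic M) => p p1.
have {p1} : map_poly intr p != 0 :> {poly D}.
  by rewrite monic_neq0 // monic_map.
elim/poly_ind: p => [|p c IH]; first by rewrite rmorph0 eqxx.
rewrite rmorphD rmorphM /= map_polyX map_polyC /= => p0.
rewrite /root !hornerE addr_eq0 => /eqP e.
have [c0|c0] := eqVneq (c%:~R : D) 0; last first.
  by exists (- (map_poly intr p).[x]), c; rewrite mulrN mulrC e opprK.
move: e p0; rewrite c0 oppr0 addr0 => /eqP; rewrite mulf_eq0 (negPf x0) orbF.
by move=> rp; rewrite mulf_eq0 negb_or => /andP[p0 _]; apply: IH.
Qed.

(** A vanishing odd integer would provide an inverse of [2], and a vanishing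
    even integer can be halved. *)
Lemma natr_neq0 (D : idomainType) : 2%:R != 0 :> D -> (forall z : D, 2%:R * z <> 1) ->
  forall m, (0 < m)%N -> m%:R != 0 :> D.
Proof.
move=> two0 twoU m; have [n] := ubnP m; elim: n m => // n IH m mn m0.
rewrite -(odd_double_half m); case: (boolP (odd m)) => [om|em].
  apply/eqP => e; apply: (twoU (- (m./2)%:R)).
  by rewrite mulrN -natrM mul2n -[LHS]add0r -e natrD addrK.
rewrite add0n -muln2 natrM mulf_neq0 // IH //; last by lia.
by rewrite (leq_trans _ (_ : m <= n)%N) //; lia.
Qed.

Section Basis.
Variables (D : idomainType).
Hypothesis char0 : forall m, (0 < m)%N -> m%:R != 0 :> D.

Lemma intr_eq0D (m : int) : (m%:~R == 0 :> D) = (m == 0).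
Proof.
have succ k : (k.+1%:R == 0 :> D) = false by rewrite (negPf (char0 _)).
by case: m => [[|m]|m]; rewrite ?eqxx ?NegzE ?mulrNz ?oppr_eq0 ?succ.
Qed.

(** A nontrivial relation becomes, after a unimodular change of generators,
    the vanishing of a multiple of the first one. *)
Lemma drop_generator n (b : 'cV[D]_n.+1) (c : 'rV[int]_n.+1) : generates b ->
  int_comb c b = 0 -> c != 0 -> exists b' : 'cV[D]_n, generates b'.
Proof.
move=> gb cb c0; have [L Lu [U Uu [d _ cE]]] := int_Smith_normal_form c.
set T := \matrix_(i, j) _ in cE; pose b1 := map_mx intr U *m b.
have T0j (j : 'I_n.+1) : j != 0 -> T 0 j = 0 by rewrite mxE; case: j => -[].
have d0 : T 0 0 != 0.
  apply: contraNneq c0 => T00; rewrite cE (_ : T = 0) ?mulmx0 ?mul0mx //.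
  apply/matrixP => i j; rewrite ord1 [RHS]mxE.
  by have [->|/T0j] := eqVneq j 0.
have b10 : b1 0 0 = 0.
  have : int_comb (invmx L *m c) b = 0.
    rewrite [invmx L]mx11_scalar mul_scalar_mx int_combE map_mxZ -scalemxAl mxE.
    by rewrite -int_combE cb mulr0.
  rewrite cE -!mulmxA mulKmx // int_comb_mul -/b1 /int_comb (bigD1 0) //=.
  rewrite big1 ?addr0 => [|j /T0j->]; last by rewrite mul0r.
  by move/eqP; rewrite mulf_eq0 intr_eq0D (negPf d0) /= => /eqP.
exists (\col_j b1 (lift ord0 j) 0) => x; have [e xE] := gb x.
pose e1 := e *m invmx U; have x1 : x = int_comb e1 b1.
  by rewrite -int_comb_mul mulmxKV.
exists (\row_j e1 0 (lift ord0 j)); rewrite x1 /int_comb big_ord_recl b10 mulr0 add0r.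
by apply: eq_bigr => i _; rewrite !mxE.
Qed.

Lemma exists_basis n (b : 'cV[D]_n) : generates b ->
  exists r (b' : 'cV[D]_r), generates b' /\ forall c, int_comb c b' = 0 -> c = 0.
Proof.
elim: n b => [|n IH] b gb.
  by exists 0%N, b; split=> // c _; apply/matrixP => i [].
have [fb|/asboolPn nfb] := pselect (forall c, int_comb c b = 0 -> c = 0).
  by exists n.+1, b.
have [c nc] : exists c, ~ (int_comb c b = 0 -> c = 0).
  apply: contrapT => nc; move/asboolPn: nfb; apply=> c.
  by apply: contrapT => nc'; apply: nc; exists c.
have [cb c0] : int_comb c b = 0 /\ c != 0.
  split; first by apply: contrapT => ?; apply: nc.
  by apply/eqP => ?; apply: nc.
by have [b' /IH] := drop_generator gb cb c0.
Qed.
End Basis.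

(** * Norms and finiteness *)

Definition covered_mod2 (R : pzRingType) (W : seq R) : Prop :=
  forall y, exists w z, w \in W /\ y = w + (z + z).

(** Matrices of multiplication in a basis. The last clause is all that remains
    of the basis: it makes [t] a root of the characteristic polynomial of
    [M t]. *)
Definition regular_rep (D : comNzRingType) r (M : D -> 'M[int]_r) : Prop :=
  [/\ {morph M : x y / x + y}, {morph M : x y / x * y >-> x *m y},
      forall k : int, M k%:~R = k%:M &
      forall t, root (map_poly intr (char_poly (M t))) t].

(** A duplicate-free list of roots of maximal length contains all of them. *)
Lemma roots_finite (D : idomainType) (p : {poly D}) : p != 0 ->
  exists l : seq D, forall x, root p x -> x \in l.
Proof.
move=> p0; pose Q k := `[< exists l : seq D, [/\ all (root p) l, uniq l & size l = k] >].
have Q0 : exists k, Q k by exists 0%N; apply/asboolP; exists [::].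
have Qub k : Q k -> (k <= size p)%N.
  by move=> /asboolP[l [rl ul <-]]; apply: ltnW; apply: max_poly_roots.
case: (ex_maxnP Q0 Qub) => k /asboolP[l [rl ul lk]] kmax.
exists l => x rx; apply/negPn/negP => xl.
have /kmax : Q k.+1 by apply/asboolP; exists (x :: l); split; rewrite /= ?rx ?xl ?lk.
by rewrite ltnn.
Qed.

Section Representation.
Variables (D : idomainType).
Hypothesis char0 : forall m, (0 < m)%N -> m%:R != 0 :> D.

Lemma int_comb0l n (b : 'cV[D]_n) : int_comb 0 b = 0.
Proof. by rewrite int_combE map_mx0 mul0mx mxE. Qed.

Lemma int_combB n (b : 'cV[D]_n) c c' :
  int_comb (c - c') b = int_comb c b - int_comb c' b.
Proof. by rewrite !int_combE map_mxB mulmxBl !mxE. Qed.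

Lemma basis_rep r (b : 'cV[D]_r) : generates b ->
  (forall c, int_comb c b = 0 -> c = 0) ->
  exists M : D -> 'M[int]_r, regular_rep M.
Proof.
move=> gb fb; have /choice[M ME] t := mul_matrix t gb.
have uniM (A A' : 'M[int]_r) : map_mx intr A *m b = map_mx intr A' *m b -> A = A'.
  move=> e; apply/row_matrixP => i; apply/eqP; rewrite -subr_eq0; apply/eqP.
  apply: fb; rewrite int_combB !rowE !int_comb_mul e; exact: subrr.
exists M; split=> [x y|x y|k|t].
- by apply: uniM; rewrite -ME map_mxD mulmxDl -!ME scalerDl.
- by apply: uniM; rewrite -ME map_mxM -mulmxA -ME -scalemxAr -ME scalerA mulrC.
- by apply: uniM; rewrite -ME map_scalar_mx mul_scalar_mx.
- exact: char_poly_root (ME t).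
Qed.

(** The [2 ^ r] combinations of the basis with coefficients in [{0, 1}] are
    pairwise incongruent modulo [2]. *)
Lemma rank_le_cover r (b : 'cV[D]_r) (W : seq D) : generates b ->
  (forall c, int_comb c b = 0 -> c = 0) -> covered_mod2 W -> (r <= size W)%N.
Proof.
move=> gb fb cW.
pose y (e : {ffun 'I_r -> bool}) := int_comb (\row_i (e i)%:Z) b.
have {cW}/choice[w wP] e : exists k : 'I_(size W), exists z, y e = W`_k + (z + z).
  have [v [z [vW ->]]] := cW (y e).
  have kW : (index v W < size W)%N by rewrite index_mem.
  by exists (Ordinal kW), z; rewrite /= nth_index.
have wI : injective w.
  move=> e e' ee'; have [z zE] := wP e; have [z' zE'] := wP e'.
  have [d dE] := gb (z - z').
  have /fb : int_comb (\row_i (e i)%:Z - \row_i (e' i)%:Z - (d + d)) b = 0.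
    have -> : d + d = d - (0 - d) by rewrite sub0r opprK.
    rewrite !int_combB int_comb0l -/(y e) -/(y e') zE zE' ee' -dE; ring.
  move/matrixP => dd; apply/ffunP => i; move: (dd 0 i); rewrite !mxE.
  by case: (e i); case: (e' i) => //= /eqP; lia.
have := leq_card w wI; rewrite card_ffun card_bool !card_ord.
by apply: leq_trans; apply: ltnW; apply: ltn_expl.
Qed.

Variables (r : nat) (M : D -> 'M[int]_r).
Hypothesis repM : regular_rep M.
Variables (n : nat) (b : 'cV[D]_n).
Hypothesis gb : generates b.

Lemma norm_mul x y : \det (M (x * y)) = \det (M x) * \det (M y).
Proof. by have [_ -> _ _] := repM; rewrite det_mulmx. Qed.

Lemma norm_int (k : int) : \det (M k%:~R) = k ^+ r.
Proof. by have [_ _ -> _] := repM; rewrite det_scalar. Qed.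

Lemma norm_neq0 x : x != 0 -> \det (M x) != 0.
Proof.
move=> /(int_multiple gb)[a [m [xa]]]; rewrite (intr_eq0D char0) => m0.
apply: contraNneq m0 => Mx0.
have := norm_int m; rewrite -xa norm_mul Mx0 mul0r => /esym/eqP.
by rewrite expf_eq0 => /andP[].
Qed.

(** The norm of an integer [k] is [k ^+ r], and norms of units are [1] or
    [- 1]. *)
Lemma natr_nonunit k (u : D) : (0 < r)%N -> (1 < k)%N -> k%:R * u <> 1.
Proof.
move=> r_gt0 k1 /(congr1 (fun x => `|\det (M x)|%N)); rewrite norm_mul.
rewrite -[k%:R]/(k%:Z%:~R) -[1]/(1%:~R) !norm_int expr1n abszM abszX => /eqP.
by rewrite muln_eq1 -[(k ^ r == 1)%N]/(k ^ r == k ^ 0)%N eqn_exp2l // -leqn0 leqNgt r_gt0.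
Qed.

(** The norms of [t + 1, ..., t + N + 1] divide the norm of [f], so they take
    finitely many values; since [r <= N] they determine the characteristic
    polynomial of [- t], by interpolation, and [t] is determined up to
    finitely many choices by that polynomial. *)
Lemma shifted_divisors_finite N (f : D) : (r <= N)%N -> f != 0 ->
  exists l : seq D, forall t,
    (forall i, (0 < i <= N.+1)%N -> exists q, (t + i%:R) * q = f) -> t \in l.
Proof.
move=> rN f0; have [MD _ MZ Mroot] := repM.
pose S t := forall i, (0 < i <= N.+1)%N -> exists q, (t + i%:R) * q = f.
pose K := `|\det (M f)|%N.
have K0 : (0 < K)%N by rewrite absz_gt0 norm_neq0.
pose p t := char_poly (M (- t)).
have M0 : M 0 = 0 by have := MZ 0; rewrite mulr0z => ->; rewrite raddf0.
have pE t i : (p t).[i%:Z] = \det (M (t + i%:R)).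
  have -> : M (t + i%:R) = (i%:Z)%:M - M (- t).
    have MN : M (- t) = - M t by apply/eqP; rewrite -addr_eq0 -MD addNr M0.
    by rewrite MN opprK MD addrC -[i%:R]/(i%:Z%:~R) MZ.
  rewrite /p /char_poly -horner_evalE -det_map_mx; congr (\det _).
  by apply/matrixP => j k; rewrite !mxE /= /horner_eval !hornerE hornerMn hornerX.
have valK t i : S t -> (i < r.+1)%N -> (`|(p t).[i.+1%:Z]| <= K)%N.
  move=> St ir; have [|q fE] := St i.+1; first by rewrite /= ltnS (leq_trans _ rN).
  rewrite pE /K -fE norm_mul abszM leq_pmulr // absz_gt0.
  by apply: norm_neq0; apply: contraNneq f0 => q0; rewrite -fE q0 mulr0.
pose v t : {ffun 'I_r.+1 -> 'I_K.+1 * bool} :=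
  [ffun i : 'I_r.+1 => (inord `|(p t).[i.+1%:Z]|%N, (p t).[i.+1%:Z] < 0)].
have vp t t' : S t -> S t' -> v t = v t' -> p t = p t'.
  move=> St St' /ffunP vv; apply/eqP; rewrite -subr_eq0; apply/eqP.
  apply: (@roots_geq_poly_eq0 _ _ [seq i.+1%:Z | i <- iota 0 r.+1]).
  - apply/allP => _ /mapP[i + ->]; rewrite mem_iota add0n /= => ir.
    have := vv (Ordinal ir); rewrite !ffunE /= => -[/(congr1 val) + sg].
    rewrite /= !inordK ?ltnS ?valK // => ab.
    rewrite /root hornerD hornerN subr_eq0; apply/eqP.
    by move: {vv} (_.[_]) (_.[_]) ab sg => x y; lia.
  - by rewrite map_inj_uniq ?iota_uniq // => i j [].
  rewrite size_map size_iota (leq_trans (size_polyD _ _)) //.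
  by rewrite size_polyN !size_char_poly maxnn.
have fiber a : exists l : seq D, forall t, S t -> v t = a -> t \in l.
  have [[t0 [St0 <-]]|no] := pselect (exists t0, S t0 /\ v t0 = a); last first.
    by exists [::] => t St va; case: no; exists t.
  have [|l lP] := @roots_finite D (map_poly intr (p t0)).
    by rewrite monic_neq0 // monic_map // char_poly_monic.
  exists (map -%R l) => t St /(vp _ _ St St0) pt.
  by rewrite -[t]opprK; apply: map_f; apply: lP; rewrite -pt; apply: Mroot.
have [l lP] := choice fiber.
exists (flatten [seq l a | a : {ffun 'I_r.+1 -> 'I_K.+1 * bool}]) => t St.
by apply/flattenP; exists (l (v t)); [apply: image_f | apply: lP].
Qed.
End Representation.

(** * Defining the natural numbers in a domain *)

(** A set of [t] coded by [f], [g] and [h]: the divisibility conditions confine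
    [t] to a finite set modulo [P] that depends on [f] only, when [f] is outside
    [P] and the quotient by [P] is a domain of characteristic zero and of rank
    at most [N] over the integers; failure of comaximality with [h] then
    selects a subset of it. *)
Definition coded (R : pzRingType) (P : R -> Prop) (N : nat) (f g h t : R) : Prop :=
  (forall i, i \in iota 1 N.+1 -> exists q, P ((t + i%:R) * q - f)) /\
  ~ exists u v, P (u * (1 + (t + 1) * g) + v * h - 1).

(** In a quotient of characteristic zero where coded sets are finite, no coded
    set contains all the natural numbers: induction from [0] inside the set has
    to stop, and it can only stop at [x]. *)
Definition nat_mod (R : pzRingType) (P : R -> Prop) (N : nat) (x : R) : Prop :=
  exists f g h, ~ P f /\ (coded P N f g h 0 /\
    forall t, coded P N f g h t -> P (t - x) \/ coded P N f g h (t + 1)).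

Lemma nat_mod_quot (R D : pzRingType) (P : R -> Prop) (p : {rmorphism R -> D}) N x :
  (forall y, exists x, p x = y) -> (forall x, p x = 0 <-> P x) ->
  nat_mod P N x <-> nat_mod (fun y => y = 0) N (p x).
Proof.
move=> psurj pP.
have codedE f g h t : coded P N f g h t <-> coded (fun y => y = 0) N (p f) (p g) (p h) (p t).
  split=> -[df nc]; (split=> [i /df[q qE]|]).
  - by exists (p q); move/pP: qE; rewrite rmorphB rmorphM rmorphD rmorph_nat.
  - case=> u' [v']; have [u <-] := psurj u'; have [v <-] := psurj v' => e.
    apply: nc; exists u, v; apply/pP.
    by rewrite rmorphB rmorphD !rmorphM rmorphD rmorphM rmorphD !rmorph1.
  - have [q' q'E] := psurj q; exists q'; apply/pP.
    by rewrite rmorphB rmorphM rmorphD rmorph_nat q'E.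
  case=> u [v /pP e]; apply: nc; exists (p u), (p v); move: e.
  by rewrite rmorphB rmorphD !rmorphM rmorphD rmorphM rmorphD !rmorph1.
split.
- case=> f [g [h [nPf [c0 cS]]]]; exists (p f), (p g), (p h).
  split; first by move/pP.
  split; first by move/codedE: c0; rewrite rmorph0.
  move=> t'; have [t <-] := psurj t' => /codedE/cS[/pP|/codedE];
    rewrite ?rmorphB ?rmorphD ?rmorph1.
    by left.
  by right.
- case=> f' [g' [h']]; have [f <-] := psurj f'; have [g <-] := psurj g'.
  have [h <-] := psurj h' => -[nPf [c0 cS]]; exists f, g, h.
  split; first by move/pP.
  split; first by apply/codedE; rewrite rmorph0.
  move=> t /codedE/cS[e|e]; [left; apply/pP; rewrite rmorphB // | right; apply/codedE].
  by rewrite rmorphD rmorph1.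
Qed.

Section NaturalNumbers.
Variables (D : idomainType) (n : nat) (b : 'cV[D]_n) (W : seq D).
Hypothesis gb : generates b.
Hypothesis coverW : covered_mod2 W.
Hypothesis char0 : forall m, (0 < m)%N -> m%:R != 0 :> D.

Lemma domain_rep : exists r (M : D -> 'M[int]_r),
  [/\ regular_rep M, (0 < r)%N & (r <= size W)%N].
Proof.
have [r [b' [gb' fb']]] := exists_basis char0 gb.
have [M repM] := basis_rep gb' fb'.
exists r, M; split=> //; last exact: rank_le_cover gb' fb' coverW.
case: r b' gb' {fb' M repM} => // b' gb'; have [c] := gb' 1.
by rewrite /int_comb big_ord0 => /eqP; rewrite oner_eq0.
Qed.

Lemma common_multiple (l : seq D) : (forall x, x \in l -> x != 0) ->
  exists2 G, (0 < G)%N & forall x, x \in l -> exists c, x * c = G%:R.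
Proof.
elim: l => [|a l IH] l0; first by exists 1%N.
have [|G G0 GP] := IH; first by move=> x xl; apply: l0; rewrite inE xl orbT.
have [c [k [ack k0]]] := int_multiple gb (l0 a (mem_head _ _)).
have [c' ac'] : exists c', a * c' = `|k|%N%:R.
  case: (lerP 0 k) => k_sg; [exists c | exists (- c)]; rewrite ?mulrN ack.
    by rewrite -[in LHS](gez0_abs k_sg).
  by rewrite -[in LHS](opprK k) -(ltz0_abs k_sg) mulrNz opprK.
have k1 : (0 < `|k|)%N by rewrite absz_gt0; apply: contraNneq k0 => ->.
exists (`|k| * G)%N; first by rewrite muln_gt0 k1.
move=> x; rewrite inE => /orP[/eqP->|/GP[d dE]].
  by exists (c' * G%:R); rewrite mulrA ac' natrM.
by exists (d * `|k|%N%:R); rewrite mulrA dE natrM mulrC.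
Qed.

Lemma comaximal_prod (I : eqType) (s : seq I) (e : D) (F : I -> D) :
  (forall i, i \in s -> exists u v, u * e + v * F i = 1) ->
  exists u v, u * e + v * \prod_(i <- s) F i = 1.
Proof.
move=> cF; rewrite big_seq; elim/big_rec: _ => [|i y /cF[u' [v' uv']] [u [v uv]]].
  by exists 0, 1; ring.
exists (u' * u * e + u' * v * y + v' * u * F i), (v' * v).
by rewrite -[RHS]mulr1 -{1}uv' -uv; ring.
Qed.

(** If [N] bounds the rank then the coded sets are finite, so a coded set
    that contains [0] and is closed under successor except at [x] forces [x]
    to be a natural number. Conversely, for [m] take [f] divisible by all the
    [j + i] with [j <= m] and [1 <= i <= N + 1]; this leaves finitely many
    candidates [t], among which are all these [j]. Take for [g] a positive integer divisible by the nonzero differences [t - j], and for [h]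
    the product of the [1 + (j + 1) g] for [j <= m]: a candidate [t] gives an
    element [1 + (t + 1) g] comaximal with [h] unless [t] is one of these [j]. *)
Lemma nat_modP x : nat_mod (fun y : D => y = 0) (size W) x <-> exists m : nat, x = m%:R.
Proof.
have [r [M [repM r0 rW]]] := domain_rep.
pose S (t f : D) := forall i, i \in iota 1 (size W).+1 ->
  exists q, (t + i%:R) * q - f = 0.
have finS f : f != 0 -> exists l : seq D, forall t, S t f -> t \in l.
  move=> f0; have [l lP] := shifted_divisors_finite char0 repM gb rW f0.
  exists l => t St; apply: lP => i iN; have [|q /eqP] := St i.
    by rewrite mem_iota add1n ltnS.
  by rewrite subr_eq0 => /eqP<-; exists q.
have natrI : injective (fun k => k%:R : D).
  move=> i j; wlog ij : i j / (i <= j)%N.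
    by move=> wl; case: (leqP i j) => [/wl//|/ltnW/wl ji /esym/ji].
  move=> /eqP; rewrite eq_sym -subr_eq0 -natrB // => e; apply/eqP.
  rewrite eqn_leq ij -subn_eq0 -leqn0 leqNgt; apply/negP => /char0.
  by rewrite e.
split=> [[f [g [h [/eqP f0 [c0 cS]]]]]|[m ->{x}]].
- apply: contrapT => notnat.
  have [l lP] := finS f f0.
  have allS k : coded (fun y => y = 0) (size W) f g h k%:R.
    elim: k => // k /cS[/eqP|]; last by rewrite -natr1.
    by rewrite subr_eq0 => /eqP e; case: notnat; exists k.
  have : (size [seq k%:R : D | k <- iota 0 (size l).+1] <= size l)%N.
    apply: uniq_leq_size; first by rewrite map_inj_uniq ?iota_uniq.
    by move=> _ /mapP[k _ ->]; apply: lP; case: (allS k).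
  by rewrite size_map size_iota ltnn.
- pose f : D := (m + (size W).+1)`!%:R.
  have f0 : f != 0 by apply: char0; apply: fact_gt0.
  have [l lP] := finS f f0.
  pose diffs := [seq y <- [seq t - j%:R | t <- l, j <- iota 0 m.+1] | y != 0].
  have [|G G0 GP] := @common_multiple diffs; first by move=> y; rewrite mem_filter => /andP[].
  pose F j : D := 1 + (j%:R + 1) * G%:R.
  pose h := \prod_(j <- iota 0 m.+1) F j.
  have codedj j : (j <= m)%N -> coded (fun y => y = 0) (size W) f G%:R h j%:R.
    move=> jm; split=> [i|[u [v /eqP]]].
      rewrite mem_iota => /andP[i1 iW]; have /dvdnP[q qE] : (j + i %| (m + (size W).+1)`!)%N.
        by rewrite dvdn_fact //; lia.
      by exists q%:R; rewrite -natrD -natrM mulnC -qE subrr.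
    rewrite /h (bigD1_seq j) ?iota_uniq ?mem_iota //= mulrCA [u * _]mulrC -mulrDr subr_eq0.
    have -> : 1 + (j%:R + 1) * G%:R = (1 + j.+1 * G)%N%:R :> D.
      by rewrite natrD natrM -[j.+1%:R]natr1.
    by move/eqP; apply: (natr_nonunit repM r0); lia.
  exists f, G%:R, h; split; first exact/eqP.
  split; first exact: (codedj 0%N).
  move=> t [tf tnc]; have [[j [jm ->]]|notj] := pselect (exists j, (j <= m)%N /\ t = j%:R).
    have [->|jm'] := eqVneq j m; [by left; rewrite subrr | right].
    by rewrite natr1; apply: codedj; lia.
  case: tnc; have [|u [v uv]] := @comaximal_prod _ (iota 0 m.+1) (1 + (t + 1) * G%:R) F.
    move=> j; rewrite mem_iota /= add0n ltnS => jm.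
    have [|c cE] := GP (t - j%:R).
      rewrite mem_filter subr_eq0; apply/andP; split.
        by apply/eqP => e; apply: notj; exists j.
      by apply: allpairs_f; [apply: lP | rewrite mem_iota].
    (* With [e = 1 + (t + 1) g], both [e - (t + 1) g = 1] and
       [c (e - F j) = c (t - j) g = g ^+ 2]: square the former equality and
       substitute the latter. *)
    exists (1 + (t + 1) * G%:R - 2%:R * (t + 1) * G%:R + (t + 1) ^+ 2 * c).
    by exists (- ((t + 1) ^+ 2 * c)); rewrite /F -cE; ring.
  by exists u, v; rewrite uv subrr.
Qed.
End NaturalNumbers.

(** * Terms, closures and invariance under isomorphism *)

Section Syntax.

Definition term_muln (t : L1_term) (m : nat) : L1_term := iter m (TAdd t) TZero.

Definition term_comb (n : nat) (m : nat -> nat) : L1_term :=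
  foldr (fun i => TAdd (term_muln (TVar i) (m i))) TZero (iota 0 n).

Definition nat_comb (V : nmodType) (x : nat -> V) (n : nat) (m : nat -> nat) : V :=
  \sum_(i < n) x i *+ m i.

Lemma term_eval_comb (R : pzRingType) (e : nat -> R) n m :
  term_eval e (term_comb n m) = nat_comb e n m.
Proof.
rewrite /nat_comb -(big_mkord xpredT (fun i => e i *+ m i)) /term_comb /index_iota subn0.
elim: (iota 0 n) => [|i s IH]; first by rewrite big_nil.
rewrite big_cons /= IH; congr (_ + _).
by elim: (m i) => //= k ->; rewrite mulrS.
Qed.

(** The truth value of the formulas built below is the same for all valuations,
    so quantifying over all their free variables makes sentences of them
    without any bookkeeping of variables. *)
Definition all_closure (phi : L1_formula) : L1_formula :=
  foldr FAll phi (free_vars phi).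

Lemma all_closure_sentence phi : L1_sentence (all_closure phi).
Proof.
rewrite /L1_sentence /all_closure.
have fvE s : free_vars (foldr FAll phi s) = [seq j <- free_vars phi | j \notin s].
  elim: s => [|i s IH] /=; first by rewrite filter_predT.
  rewrite IH -filter_predI; apply: eq_filter => j /=.
  by rewrite inE negb_or.
rewrite fvE; apply/eqP; rewrite -(negbK (_ == _)) -has_filter.
by apply/hasPn => j ->.
Qed.

Lemma eta_with_id (T : Type) (e : nat -> T) i j : [eta e with i |-> e i] j = e j.
Proof. by rewrite /=; case: eqVneq => [->|]. Qed.

Lemma models_all_closure (R : pzRingType) phi :
  models R (all_closure phi) <-> models R phi.
Proof.
rewrite /all_closure; elim: (free_vars phi) => //= i s IH; rewrite -IH.
split=> [H e|H e x]; last exact: H.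
by have := H e (e i); apply: (L1_holds_eq _).1 => j _; apply: eta_with_id.
Qed.

Lemma L1_holds_exs (R : pzRingType) n (phi : L1_formula) (e : nat -> R) :
  L1_holds e (foldr FEx phi (iota 0 n)) <->
  exists e', (forall i, (n <= i)%N -> e' i = e i) /\ L1_holds e' phi.
Proof.
have [s sE] : exists s, s = iota 0 n by exists (iota 0 n).
transitivity (exists e', (forall i, i \notin iota 0 n -> e' i = e i) /\ L1_holds e' phi).
  rewrite -sE {sE}; elim: s e => [|k s IH] e /=.
    split=> [H|[e' [ee']]]; first by exists e.
    by apply: (L1_holds_eq _).1 => j _; apply: ee'.
  split=> [[x /IH[e' [ee' H]]]|[e' [ee' H]]].
    exists e'; split=> // i; rewrite inE negb_or => /andP[ik /ee'].
    by rewrite /= (negPf ik).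
  exists (e' k); apply/IH; exists e'; split=> // i is' /=.
  by case: eqVneq => [->//|ik]; apply: ee'; rewrite inE negb_or ik.
by split=> -[e' [ee' H]]; exists e'; split=> // i; have := ee' i;
  rewrite mem_iota add0n /= -leqNgt.
Qed.

Lemma L1_holds_iso (R S : pzRingType) (g : {rmorphism R -> S}) phi (e : nat -> R) :
  bijective g -> L1_holds e phi <-> L1_holds (g \o e) phi.
Proof.
move=> [h gK hK].
have gI := can_inj gK.
have evalE (e' : nat -> R) t : term_eval (g \o e') t = g (term_eval e' t).
  elim: t => [i|||t1 IH1 t2 IH2|t1 IH1 t2 IH2] //=; rewrite ?rmorph0 ?rmorph1 //.
    by rewrite IH1 IH2 rmorphD.
  by rewrite IH1 IH2 rmorphM.
have upd i p x (e' : nat -> R) : L1_holds [eta g \o e' with i |-> g x] p <->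
    L1_holds (g \o [eta e' with i |-> x]) p.
  by apply: L1_holds_eq => j _ /=; case: eqP.
elim: phi e => [t1 t2|p IHp|p IHp q IHq|p IHp q IHq|p IHp q IHq|i p IHp|i p IHp] e /=.
- by rewrite !evalE; split=> [->|/gI].
- by rewrite IHp.
- by rewrite IHp IHq.
- by rewrite IHp IHq.
- by rewrite IHp IHq.
- split=> [H y|H x]; last by apply/IHp/upd/H.
  by rewrite -[y]hK; apply/upd/IHp/H.
- split=> [[x /IHp H]|[y H]]; first by exists (g x); apply/upd.
  by exists (h y); apply/IHp/upd; rewrite hK.
Qed.
End Syntax.

(** * Finite presentation *)

Definition nat_generates (V : nmodType) (n : nat) (s : nat -> V) : Prop :=
  forall u, exists m, u = nat_comb s n m.

Lemma nat_combD (V : nmodType) (x : nat -> V) n m m' :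
  nat_comb x n (fun i => m i + m' i)%N = nat_comb x n m + nat_comb x n m'.
Proof. by rewrite -big_split; apply: eq_bigr => i _; rewrite mulrnDr. Qed.

Lemma nat_comb_delta (V : nmodType) (x : nat -> V) n i : (i < n)%N ->
  nat_comb x n (fun j => j == i) = x i.
Proof.
move=> i_n; rewrite /nat_comb (bigD1 (Ordinal i_n)) //= eqxx mulr1n big1 ?addr0 // => j.
by rewrite -val_eqE /= => /negPf->.
Qed.

Definition pos_part n (z : 'rV[int]_n) (i : nat) : nat :=
  if (insub i : option 'I_n) is Some j then
    (if 0 <= z 0 j then absz (z 0 j) else 0%N) else 0%N.

Lemma nat_comb_pos_part (V : zmodType) (x : nat -> V) n (z : 'rV[int]_n) :
  nat_comb x n (pos_part z) - nat_comb x n (pos_part (- z)) =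
  \sum_(i < n) x i *~ z 0 i.
Proof.
rewrite /nat_comb -sumrB; apply: eq_bigr => i _; rewrite /pos_part valK mxE.
by case: (z 0 i) => [[|k]|k]; rewrite ?subrr // ?subr0 // sub0r.
Qed.

Lemma FDZ_nat_generates (A : pzRingType) : FDZ A ->
  exists n (s : nat -> A), nat_generates n s.
Proof.
case=> n [s sP]; exists (n + n)%N, (fun i => if (i < n)%N then s`_i else - s`_(i - n)).
move=> u; have [a ->] := sP u; pose z : 'rV[int]_n := \row_i a i.
exists (fun i => if (i < n)%N then pos_part z i else pos_part (- z) (i - n)).
have -> : \sum_(i < n) s`_i *~ a i = \sum_(i < n) s`_i *~ z 0 i.
  by apply: eq_bigr => i _; rewrite mxE.
rewrite -nat_comb_pos_part /nat_comb -sumrN big_split_ord; congr (_ + _).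
  by apply: eq_bigr => i _; rewrite /= ltn_ord.
by apply: eq_bigr => i _; rewrite /= ltnNge leq_addr /= addKn mulNrn.
Qed.

(** The relations between the generators form a subgroup of a finitely
    generated free group. *)
Lemma relations_fg (V : zmodType) n (s : nat -> V) :
  exists E : seq 'rV[int]_n,
    (forall z, z \in E -> nat_comb s n (pos_part z) = nat_comb s n (pos_part (- z))) /\
    forall (U : zmodType) (x : nat -> U),
      (forall z, z \in E -> nat_comb x n (pos_part z) = nat_comb x n (pos_part (- z))) ->
      forall m m', nat_comb s n m = nat_comb s n m' -> nat_comb x n m = nat_comb x n m'.
Proof.
pose ev (U : zmodType) (x : nat -> U) (z : 'rV[int]_n) := \sum_(i < n) x i *~ z 0 i.
have evB U x z z' : ev U x (z - z') = ev U x z - ev U x z'.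
  by rewrite /ev -sumrB; apply: eq_bigr => i _; rewrite !mxE mulrzBr.
have ker_sub U x : subgroup (fun z => ev U x z = 0).
  split; first by rewrite /ev big1 // => i _; rewrite mxE.
  by move=> z z' z0 z0'; rewrite evB z0 z0' subr0.
have ev0P U x z : ev U x z = 0 <-> nat_comb x n (pos_part z) = nat_comb x n (pos_part (- z)).
  rewrite /ev -nat_comb_pos_part.
  by split=> [/eqP|->]; rewrite ?subrr // subr_eq0 => /eqP.
have [|E [EH HE]] := @subgroup_fg _ [seq delta_mx 0 i | i <- enum 'I_n] _ (ker_sub V s).
  move=> z _.
  have sS := zspan_subgroup [seq delta_mx (0 : 'I_1) i : 'rV[int]_n | i <- enum 'I_n].
  rewrite (row_sum_delta z); elim/big_ind: _ => [|u v|i _]; [exact: sS.1 | exact: subgroupD |].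
  rewrite -[z 0 i]intz scaler_int; apply: subgroupMz => //; apply: zspan_mem.
  by apply: map_f; rewrite mem_enum.
exists E; split=> [z /EH/ev0P //|U x xE m m' mm'].
pose z : 'rV[int]_n := \row_i ((m i)%:Z - (m' i)%:Z).
have evz (W : zmodType) (y : nat -> W) : ev W y z = nat_comb y n m - nat_comb y n m'.
  by rewrite /ev /nat_comb -sumrB; apply: eq_bigr => i _; rewrite mxE mulrzBr.
apply/eqP; rewrite -subr_eq0 -evz; apply/eqP.
apply: (zspan_sub (ker_sub U x) (s := E)); first by move=> w /xE/ev0P.
by apply: HE; rewrite evz mm' subrr.
Qed.

Definition FTrue : L1_formula := FEq TZero TZero.

(** The formula consists of finitely many generators of the relations between
    the [s i], of their multiplication table and of the expression of [1]. *)
Lemma finite_presentation (A : comPzRingType) n (s : nat -> A) : nat_generates n s ->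
  exists rho : L1_formula, forall (B : comPzRingType) (e : nat -> B),
    L1_holds e rho <-> exists f : {rmorphism A -> B}, forall i, (i < n)%N -> e i = f (s i).
Proof.
move=> gs; have [cf cfE] := choice gs.
have [E [Es EP]] := relations_fg n s.
pose FBig := foldr FAnd FTrue.
have BigP (I : eqType) (l : seq I) (F : I -> L1_formula) (B : comPzRingType) (e : nat -> B) :
    L1_holds e (FBig (map F l)) <-> forall i, i \in l -> L1_holds e (F i).
  elim: l => //= i l ->; split=> [[Hi Hl] j|H].
    by rewrite inE => /orP[/eqP->|/Hl].
  by split=> [|j jl]; apply: H; rewrite inE ?eqxx // jl orbT.
pose additive_part := FBig
  [seq FEq (term_comb n (pos_part z)) (term_comb n (pos_part (- z))) | z <- E].
pose mul_part := FBig [seq FEq (TMul (TVar p.1) (TVar p.2)) (term_comb n (cf (s p.1 * s p.2)))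
                      | p <- [seq (i, j) | i <- iota 0 n, j <- iota 0 n]].
exists (FAnd additive_part (FAnd mul_part (FEq TOne (term_comb n (cf 1))))) => B e.
rewrite /= !BigP; split; last first.
  case=> f ef; have fE m : nat_comb e n m = f (nat_comb s n m).
    by rewrite /nat_comb rmorph_sum; apply: eq_bigr => i _; rewrite ef // rmorphMn.
  split; first by move=> z zE /=; rewrite !term_eval_comb !fE Es.
  split; last by rewrite term_eval_comb fE -cfE rmorph1.
  move=> p /allpairsP[[i j] [/=]]; rewrite !mem_iota /= !add0n => i_n jn -> /=.
  by rewrite term_eval_comb fE -cfE rmorphM !ef.
case=> addE [mulE]; rewrite term_eval_comb => oneE.
have {}EP := EP B e _; have {}addE z : z \in E ->
  nat_comb e n (pos_part z) = nat_comb e n (pos_part (- z)).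
  by move=> /addE /=; rewrite !term_eval_comb.
have {}EP := EP addE.
pose f u := nat_comb e n (cf u).
have fE m : f (nat_comb s n m) = nat_comb e n m by apply: EP; rewrite -cfE.
have fD u v : f (u + v) = f u + f v.
  by rewrite [in LHS](cfE u) [in LHS](cfE v) -nat_combD fE nat_combD.
have fs i : (i < n)%N -> f (s i) = e i.
  by move=> i_n; rewrite -[s i](nat_comb_delta s i_n) fE nat_comb_delta.
have f0 : f 0 = 0 by apply: (addrI (f 0)); rewrite -fD !addr0.
have fB : zmod_morphism f.
  by move=> u v; apply: (addIr (f v)); rewrite -fD !subrK.
have fMn u k : f (u *+ k) = f u *+ k.
  by elim: k => [|k IH]; rewrite ?mulr0n ?f0 // !mulrS fD IH.
have fsum (F : 'I_n -> A) : f (\sum_i F i) = \sum_i f (F i).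
  exact: (big_morph f fD f0).
have fM : monoid_morphism f.
  split=> [|u v]; first by rewrite /f -oneE.
  rewrite [in LHS](cfE u) [in LHS](cfE v) /nat_comb mulr_suml fsum [f u]/f /nat_comb mulr_suml.
  apply: eq_bigr => i _; rewrite mulr_sumr fsum [f v]/f /nat_comb mulr_sumr.
  apply: eq_bigr => j _; rewrite mulrnAl mulrnAr !fMn mulrnAl mulrnAr; congr (_ *+ _ *+ _).
  rewrite /f -term_eval_comb; symmetry.
  by apply: (mulE (val i, val j)); apply: allpairs_f; rewrite mem_iota /= add0n.
pose fr : {rmorphism A -> B} := HB.pack f (GRing.isZmodMorphism.Build A B f fB)
  (GRing.isMonoidMorphism.Build A B f fM).
by exists fr => i i_n; rewrite /= fs.
Qed.

(** * Relations definable from the images of the elements of a ring *)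

(** The values of [k] quantified variables, as nested pairs, the most recent
    one outermost: in this form the rules [def_all] and [def_ex] below apply by
    unification to quantified statements as they are usually written. *)
Definition context (B : Type) (k : nat) : Type := iter k (fun T => T * B)%type unit.

Fixpoint context_of (B : Type) (e : nat -> B) (n k : nat) : context B k :=
  if k is k'.+1 then (context_of e n k', e (n + k')%N) else tt.

Section Definability.
Variables (A : comPzRingType) (n : nat) (s : nat -> A).
Hypothesis gs : nat_generates n s.

(** Variables below [n] are reserved for the images of the generators; the
    quantified variables are numbered from [n] on. *)
Definition interprets (B : comPzRingType) (f : A -> B) (e : nat -> B) : Prop :=
  forall i, (i < n)%N -> e i = f (s i).

Definition def_term k (t : forall B : comPzRingType, (A -> B) -> context B k -> B) : Prop :=
  exists T, forall (B : comPzRingType) (f : {rmorphism A -> B}) e,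
    interprets f e -> term_eval e T = t B f (context_of e n k).

Definition def_form k (Q : forall B : comPzRingType, (A -> B) -> context B k -> Prop) : Prop :=
  exists phi, forall (B : comPzRingType) (f : {rmorphism A -> B}) e,
    interprets f e -> L1_holds e phi <-> Q B f (context_of e n k).

(** Natural combinations of the generators are terms of the language, hence
    every element of [A] can be used as a constant. *)
Lemma def_const k (a : A) : @def_term k (fun B f v => f a).
Proof.
have [m ->] := gs a; exists (term_comb n m) => B f e fe.
rewrite term_eval_comb /nat_comb rmorph_sum; apply: eq_bigr => i _.
by rewrite fe // rmorphMn.
Qed.

Lemma def_var k : @def_term k.+1 (fun B f v => v.2).
Proof. by exists (TVar (n + k)). Qed.

Lemma def_lift k t : @def_term k t -> @def_term k.+1 (fun B f v => t B f v.1).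
Proof. by case=> T TE; exists T => B f e /TE ->. Qed.

Lemma def_add k t u : @def_term k t -> @def_term k u ->
  @def_term k (fun B f v => t B f v + u B f v).
Proof.
by case=> T TE [U UE]; exists (TAdd T U) => B f e fe; rewrite /= (TE _ _ _ fe) (UE _ _ _ fe).
Qed.

Lemma def_mul k t u : @def_term k t -> @def_term k u ->
  @def_term k (fun B f v => t B f v * u B f v).
Proof.
by case=> T TE [U UE]; exists (TMul T U) => B f e fe; rewrite /= (TE _ _ _ fe) (UE _ _ _ fe).
Qed.

Lemma def_zero k : @def_term k (fun B f v => 0).
Proof. by exists TZero. Qed.

Lemma def_one k : @def_term k (fun B f v => 1).
Proof. by exists TOne. Qed.

Lemma def_natr k m : @def_term k (fun B f v => m%:R).
Proof.
exists (term_muln TOne m) => B f e _; elim: m => //= m ->; by rewrite mulrS.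
Qed.

(** The constant [- 1] makes up for the absence of opposites in the
    language. *)
Lemma def_opp k t : @def_term k t -> @def_term k (fun B f v => - t B f v).
Proof.
move=> dt; have [T TE] := def_mul (def_const k (-1)) dt; exists T => B f e fe.
by rewrite (TE _ _ _ fe) rmorphN rmorph1 mulN1r.
Qed.

Lemma def_sub k t u : @def_term k t -> @def_term k u ->
  @def_term k (fun B f v => t B f v - u B f v).
Proof. by move=> dt du; apply: def_add => //; apply: def_opp. Qed.

Lemma def_eq k t u : @def_term k t -> @def_term k u ->
  @def_form k (fun B f v => t B f v = u B f v).
Proof.
by case=> T TE [U UE]; exists (FEq T U) => B f e fe; rewrite /= (TE _ _ _ fe) (UE _ _ _ fe).
Qed.

Lemma def_not k P : @def_form k P -> @def_form k (fun B f v => ~ P B f v).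
Proof. by case=> p pE; exists (FNot p) => B f e fe /=; rewrite (pE _ _ _ fe). Qed.

Lemma def_and k P Q : @def_form k P -> @def_form k Q ->
  @def_form k (fun B f v => P B f v /\ Q B f v).
Proof.
by case=> p pE [q qE]; exists (FAnd p q) => B f e fe /=; rewrite (pE _ _ _ fe) (qE _ _ _ fe).
Qed.

Lemma def_or k P Q : @def_form k P -> @def_form k Q ->
  @def_form k (fun B f v => P B f v \/ Q B f v).
Proof.
by case=> p pE [q qE]; exists (FOr p q) => B f e fe /=; rewrite (pE _ _ _ fe) (qE _ _ _ fe).
Qed.

Lemma def_imp k P Q : @def_form k P -> @def_form k Q ->
  @def_form k (fun B f v => P B f v -> Q B f v).
Proof.
by case=> p pE [q qE]; exists (FImp p q) => B f e fe /=; rewrite (pE _ _ _ fe) (qE _ _ _ fe).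
Qed.

Lemma context_of_update (B : Type) (e : nat -> B) k x :
  context_of [eta e with (n + k)%N |-> x] n k.+1 = (context_of e n k, x).
Proof.
rewrite /= eqxx; congr (_, _).
have below l : (l <= k)%N -> context_of [eta e with (n + k)%N |-> x] n l = context_of e n l.
  by elim: l => //= l IH lk; rewrite IH ?(ltnW lk) // eqn_add2l ltn_eqF.
exact: below.
Qed.

Lemma interprets_update (B : comPzRingType) (f : A -> B) e k x :
  interprets f e -> interprets f [eta e with (n + k)%N |-> x].
Proof. by move=> fe i i_n /=; rewrite ltn_eqF ?fe // ltn_addr. Qed.

Lemma def_all k (P : forall B : comPzRingType, (A -> B) -> context B k -> B -> Prop) :
  @def_form k.+1 (fun B f v => P B f v.1 v.2) ->
  @def_form k (fun B f v => forall x, P B f v x).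
Proof.
case=> p pE; exists (FAll (n + k) p) => B f e fe /=.
have pxE x := pE _ _ _ (interprets_update k x fe).
by split=> H x; move: (H x); rewrite pxE context_of_update.
Qed.

Lemma def_ex k (P : forall B : comPzRingType, (A -> B) -> context B k -> B -> Prop) :
  @def_form k.+1 (fun B f v => P B f v.1 v.2) ->
  @def_form k (fun B f v => exists x, P B f v x).
Proof.
case=> p pE; exists (FEx (n + k) p) => B f e fe /=.
have pxE x := pE _ _ _ (interprets_update k x fe).
by split=> -[x H]; exists x; move: H; rewrite pxE context_of_update.
Qed.

Lemma def_true k : @def_form k (fun B f v => True).
Proof. by exists FTrue. Qed.

Lemma def_all_in (I : eqType) (l : seq I) k
    (P : I -> forall B : comPzRingType, (A -> B) -> context B k -> Prop) :
  (forall i, i \in l -> def_form (P i)) ->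
  def_form (fun B f v => forall i, i \in l -> P i B f v).
Proof.
elim: l => [|i l IH] dP; first by exists FTrue.
have [|q qE] := IH; first by move=> j jl; apply: dP; rewrite inE jl orbT.
have [p pE] := dP i (mem_head _ _).
exists (FAnd p q) => B f e fe /=; rewrite (pE _ _ _ fe) (qE _ _ _ fe).
split=> [[Hi Hl] j|H]; first by rewrite inE => /orP[/eqP->|/Hl].
by split=> [|j jl]; apply: H; rewrite inE ?eqxx // jl orbT.
Qed.

Lemma def_ex_in (I : eqType) (l : seq I) k
    (P : I -> forall B : comPzRingType, (A -> B) -> context B k -> Prop) :
  (forall i, i \in l -> def_form (P i)) ->
  def_form (fun B f v => exists i, i \in l /\ P i B f v).
Proof.
elim: l => [|i l IH] dP.
  by exists (FNot FTrue) => B f e fe /=; split=> [[]//|[i []]].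
have [|q qE] := IH; first by move=> j jl; apply: dP; rewrite inE jl orbT.
have [p pE] := dP i (mem_head _ _).
exists (FOr p q) => B f e fe /=; rewrite (pE _ _ _ fe) (qE _ _ _ fe).
split=> [[Hi|[j [jl Hj]]]|[j [+ Hj]]].
- by exists i; rewrite mem_head.
- by exists j; rewrite inE jl orbT.
- by rewrite inE => /orP[/eqP<-|jl]; [left | right; exists j].
Qed.

Definition def_pred (P : forall B : comPzRingType, (A -> B) -> B -> Prop) : Prop :=
  forall k t, @def_term k t -> @def_form k (fun B f v => P B f (t B f v)).

Lemma sentence_of_def (Q : forall B : comPzRingType, (A -> B) -> Prop) :
  @def_form 0 (fun B f _ => Q B f) ->
  exists psi, L1_sentence psi /\ forall B : comPzRingType,
    models B psi <-> exists f : {rmorphism A -> B}, Q B f.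
Proof.
case=> phi phiE; have [rho rhoE] := finite_presentation gs.
exists (all_closure (foldr FEx (FAnd rho phi) (iota 0 n))).
split=> [|B]; first exact: all_closure_sentence.
rewrite models_all_closure; split=> [H|[f Qf] e].
  have /L1_holds_exs[e [_ /= [/rhoE[f fe]]]] := H (fun _ => 0).
  by move/(phiE _ _ _ fe) => Qf; exists f.
apply/L1_holds_exs; exists (fun i => if (i < n)%N then f (s i) else e i).
split=> [i|/=]; first by rewrite ltnNge => ->.
have fe : interprets f (fun i => if (i < n)%N then f (s i) else e i) by move=> i /= ->.
by split; [apply/rhoE; exists f | apply/(phiE _ _ _ fe)].
Qed.
End Definability.

(** * Definability of the relations used *)

Fixpoint nat_span_mod (R : pzRingType) (P : R -> Prop) (N : nat) (l : seq R) (y : R) : Prop :=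
  if l is a :: l' then
    exists z y', nat_mod P N z /\ (nat_span_mod P N l' y' /\ y = z * a + y')
  else P y.

Section DefinableRelations.
Variables (A : comPzRingType) (n : nat) (s : nat -> A).
Hypothesis gs : nat_generates n s.
Local Notation dpred := (@def_pred A n s).
Local Notation dform k := (@def_form A n s k).

Let var0 k := @def_var A n s k.
Let var1 k := def_lift (var0 k).
Let var2 k := def_lift (var1 k).
Let var3 k := def_lift (var2 k).

Lemma def_ideal_gen bs : dpred (fun B f y => ideal_gen (map f bs) y).
Proof.
elim: bs => [|b bs IH] k t dt /=; first exact: (def_eq dt (def_zero _ _ _)).
apply def_ex; apply def_ex; apply def_and; first exact: (IH _ _ (var0 _)).
apply: def_eq; first exact: (def_lift (def_lift dt)).
exact: (def_add (def_mul (var1 _) (def_const gs _ b)) (var0 _)).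
Qed.

Lemma def_colon bs b : dpred (fun B f y => colon (map f bs) (f b) y).
Proof.
by move=> k t dt; apply: (def_ideal_gen bs (def_mul dt (def_const gs _ b))).
Qed.

Section Modulo.
Variables (P : forall B : comPzRingType, (A -> B) -> B -> Prop) (N : nat).
Hypothesis dP : dpred P.

Lemma def_coded k tf tg th t : def_term n s tf -> def_term n s tg ->
  def_term n s th -> def_term n s t ->
  dform k (fun B f v => coded (P f) N (tf B f v) (tg B f v) (th B f v) (t B f v)).
Proof.
move=> df dg dh dt; apply def_and.
  apply def_all_in => i _; apply def_ex; apply: dP.
  apply: (def_sub gs _ (def_lift df)); apply: (def_mul _ (var0 _)).
  exact: (def_add (def_lift dt) (def_natr _ _ _ _)).
apply def_not; apply def_ex; apply def_ex; apply: dP.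
apply: (def_sub gs _ (def_one _ _ _)).
apply: (def_add (def_mul (var1 _) _) (def_mul (var0 _) (def_lift (def_lift dh)))).
apply: (def_add (def_one _ _ _) (def_mul _ (def_lift (def_lift dg)))).
exact: (def_add (def_lift (def_lift dt)) (def_one _ _ _)).
Qed.

Lemma def_nat_mod : dpred (fun B f y => nat_mod (P f) N y).
Proof.
move=> k t dt; apply def_ex; apply def_ex; apply def_ex; apply def_and.
  by apply def_not; apply: (dP (var2 _)).
apply def_and.
  exact: (def_coded (var2 _) (var1 _) (var0 _) (def_zero _ _ _)).
apply def_all; apply def_imp.
  exact: (def_coded (var3 _) (var2 _) (var1 _) (var0 _)).
apply def_or.
  apply: dP; apply: (def_sub gs (var0 _)).
  exact: (def_lift (def_lift (def_lift (def_lift dt)))).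
exact: (def_coded (var3 _) (var2 _) (var1 _) (def_add (var0 _) (def_one _ _ _))).
Qed.

Lemma def_nat_span_mod l : dpred (fun B f y => nat_span_mod (P f) N (map f l) y).
Proof.
elim: l => [|a l IH] k t dt /=; first exact: dP.
apply def_ex; apply def_ex; apply def_and; first exact: (def_nat_mod (var1 _)).
apply def_and; first exact: (IH _ _ (var0 _)).
apply: def_eq; first exact: (def_lift (def_lift dt)).
exact: (def_add (def_mul (var1 _) (def_const gs _ a)) (var0 _)).
Qed.
End Modulo.
End DefinableRelations.

(** * Controlling one step of the filtration *)

Section PrimeIdealArithmetic.
Variables (R : comPzRingType) (P : R -> Prop).
Hypothesis FR : FDZ R.
Hypothesis Pprime : prime_ideal P.

Lemma quotient_generates (D : pzRingType) (p : {rmorphism R -> D}) :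
  (forall y, exists x, p x = y) -> exists n (b : 'cV[D]_n), generates b.
Proof.
move=> psurj; have [l lP] := FDZ_zspan FR.
exists (size l), (map_mx p (\col_(i < size l) l`_i)) => y; have [x <-] := psurj y.
have [c ->] := zspan_int_comb (lP x); exists c.
by rewrite /int_comb rmorph_sum; apply: eq_bigr => i _; rewrite !mxE rmorphM rmorph_int.
Qed.

Lemma prime_int_multiple c : ~ P c ->
  exists a (m : int), P (c * a - m%:~R) /\ ~ P m%:~R.
Proof.
move=> nPc; have [D [p [psurj pP]]] := prime_quotient Pprime.
have [n [b gb]] := quotient_generates psurj.
have [|a' [m [e m0]]] := int_multiple gb (x := p c); first by apply/eqP => /pP.
have [a aE] := psurj a'; exists a, m; rewrite -!pP rmorphB rmorphM rmorph_int aE e subrr.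
by split=> //; apply/eqP.
Qed.

Lemma two_nonunit_mod z : (forall m, (0 < m)%N -> ~ P m%:R) -> ~ P (2%:R * z - 1).
Proof.
move=> char0; have [D [p [psurj pP]]] := prime_quotient Pprime.
have [n [b gb]] := quotient_generates psurj.
have char0D m : (0 < m)%N -> m%:R != 0 :> D.
  by move=> /char0 nPm; apply/eqP; rewrite -(rmorph_nat p) => /pP.
have [r [b' [gb' fb']]] := exists_basis char0D gb.
have [M repM] := basis_rep gb' fb'.
move/pP/eqP; rewrite rmorphB rmorphM rmorph1 rmorph_nat subr_eq0 => /eqP.
apply: (natr_nonunit repM) => //.
case: r b' gb' {fb' M repM} => // b' gb'; have [c] := gb' 1.
by rewrite /int_comb big_ord0 => /eqP; rewrite oner_eq0.
Qed.

Lemma char0_mod : ~ P 2%:R -> (forall z, ~ P (2%:R * z - 1)) ->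
  forall m, (0 < m)%N -> ~ P m%:R.
Proof.
move=> nP2 nPu m m0; have [D [p [psurj pP]]] := prime_quotient Pprime.
move/pP; apply/eqP; rewrite rmorph_nat; apply: natr_neq0 m0.
  by apply/eqP; rewrite -(rmorph_nat p) => /pP.
move=> y; have [z <-] := psurj y => e; apply: (nPu z).
by apply/pP; rewrite rmorphB rmorphM rmorph1 rmorph_nat e subrr.
Qed.

Lemma nat_mod_prime (W : seq R) x : (forall m, (0 < m)%N -> ~ P m%:R) ->
  covered_mod2 W -> nat_mod P (size W) x <-> exists m : nat, P (x - m%:R).
Proof.
move=> char0 cW; have [D [p [psurj pP]]] := prime_quotient Pprime.
have [n [b gb]] := quotient_generates psurj.
have char0D m : (0 < m)%N -> m%:R != 0 :> D.
  by move=> /char0 nPm; apply/eqP; rewrite -(rmorph_nat p) => /pP.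
have cpW : covered_mod2 (map p W).
  move=> y'; have [y <-] := psurj y'; have [w [z [wW ->]]] := cW y.
  by exists (p w), (p z); rewrite !rmorphD map_f.
rewrite (nat_mod_quot _ _ psurj pP) -(size_map p) (nat_modP gb cpW char0D).
split=> -[m e]; exists m.
  by apply/pP; rewrite rmorphB rmorph_nat e subrr.
by move/pP/eqP: e; rewrite rmorphB rmorph_nat subr_eq0 => /eqP.
Qed.
End PrimeIdealArithmetic.

Lemma ideal_gen_rmorph (A B : pzRingType) (f : {rmorphism A -> B}) bs y :
  ideal_gen bs y -> ideal_gen (map f bs) (f y).
Proof.
elim: bs y => [|a bs IH] y /=; first by move=> ->; rewrite rmorph0.
case=> c [y' [/IH Iy ->]]; exists (f c), (f y'); split=> //.
by rewrite rmorphD rmorphM.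
Qed.

Lemma colon_rmorph (A B : pzRingType) (f : {rmorphism A -> B}) bs b y :
  colon bs b y -> colon (map f bs) (f b) (f y).
Proof. by rewrite /colon -rmorphM; apply: ideal_gen_rmorph. Qed.

(** The two halves serve, respectively, the surjectivity and the injectivity of
    [f], by induction along the filtration. *)
Definition step_controlled (A B : comPzRingType) (f : {rmorphism A -> B})
    (bs : seq A) (b : A) : Prop :=
  (forall c, exists a, colon (map f bs) (f b) (c - f a)) /\
  (forall c, colon (map f bs) (f b) (f c) -> colon bs b c).

Fixpoint chain_controlled (A B : comPzRingType) (f : {rmorphism A -> B}) (bs : seq A) : Prop :=
  if bs is b :: bs' then step_controlled f bs' b /\ chain_controlled f bs' else True.

Section Controlled.
Variables (A B : comPzRingType) (f : {rmorphism A -> B}).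

Lemma controlled_surj bs y : chain_controlled f bs ->
  ideal_gen (map f bs) y -> exists a, f a = y.
Proof.
elim: bs y => [|b bs IH] y /=; first by move=> _ ->; exists 0; rewrite rmorph0.
case=> -[surj _] /IH{}IH [c [y' [Iy ->]]]; have [a ca] := surj c.
have [|a' a'E] := IH ((c - f a) * f b + y').
  by apply: subgroupD => //; case: (ideal_gen_ideal (map f bs)).
by exists (a * b + a'); rewrite rmorphD rmorphM a'E; ring.
Qed.

Lemma controlled_inj bs u : chain_controlled f bs ->
  ideal_gen bs u -> f u = 0 -> u = 0.
Proof.
elim: bs u => [|b bs IH] u //= [[_ inj] /IH{}IH] [c [y [Iy uE]]] fu0.
apply: IH => //; rewrite uE; apply: subgroupD => //; first by case: (ideal_gen_ideal bs).
apply: inj; rewrite /colon.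
have -> : f c * f b = - f y by apply/eqP; rewrite -addr_eq0 -rmorphM -rmorphD -uE fu0.
by apply: subgroupN (ideal_gen_rmorph f Iy); case: (ideal_gen_ideal (map f bs)).
Qed.

Lemma controlled_bijective bs : chain_controlled f bs -> ideal_gen bs 1 -> bijective f.
Proof.
move=> cf I1; have full (R : comPzRingType) (l : seq R) y : ideal_gen l 1 -> ideal_gen l y.
  by move=> l1; rewrite -[y]mulr1; apply: (ideal_gen_ideal l).2.
have surj y : exists a, f a = y.
  apply: (controlled_surj cf); apply: full.
  by rewrite -(rmorph1 f); apply: ideal_gen_rmorph.
have [g gK] := choice surj; exists g => // u; apply/eqP; rewrite -subr_eq0; apply/eqP.
by apply: (controlled_inj cf (full _ _ _ I1)); rewrite rmorphB gK subrr.
Qed.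
End Controlled.

Section Main.
Variables (A : comPzRingType) (n : nat) (s : nat -> A).
Hypothesis FA : FDZ A.
Hypothesis gs : nat_generates n s.

Lemma nat_span_mod_comb (P : A -> Prop) N y : is_ideal P ->
  (forall m : nat, nat_mod P N m%:R) -> nat_span_mod P N (mkseq s n) y.
Proof.
move=> [[P0 _] _] natP; have [m ->] := gs y.
rewrite /nat_comb -(big_mkord xpredT (fun i => s i *+ m i)) /mkseq /index_iota subn0.
elim: (iota 0 n) => [|i l IH] /=; first by rewrite big_nil.
exists (m i)%:R, (\sum_(j <- l) s j *+ m j); split=> //; split=> //.
by rewrite big_cons mulr_natl.
Qed.

Lemma nat_span_mod_image (B : comPzRingType) (f : {rmorphism A -> B}) (P : B -> Prop) N
    (l : seq A) y : is_ideal P ->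
  (forall z, nat_mod P N z -> exists m : nat, P (z - m%:R)) ->
  nat_span_mod P N (map f l) y -> exists a, P (y - f a).
Proof.
move=> [sP PM] natP; elim: l y => [|a l IH] y /=.
  by move=> Py; exists 0; rewrite rmorph0 subr0.
case=> z [y' [/natP[m zm] [/IH[a' y'a'] ->]]]; exists (m%:R * a + a').
rewrite rmorphD rmorphM rmorph_nat.
rewrite (_ : _ - _ = f a * (z - m%:R) + (y' - f a')); last by ring.
by apply: subgroupD => //; apply: PM.
Qed.

(** A first-order condition that controls a step: it holds for the identity of
    [A], and entails control in all the rings of the class considered. *)
Definition is_step (W bs : seq A) (b : A)
    (S : forall B : comPzRingType, (A -> B) -> Prop) : Prop :=
  [/\ @def_form A n s 0 (fun B f _ => S B f), S A idfun &
      forall (B : comPzRingType) (f : {rmorphism A -> B}),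
        FDZ B -> covered_mod2 (map f W) -> S B f -> step_controlled f bs b].

Let var0 k := @def_var A n s k.
Let var1 k := def_lift (var0 k).

Lemma finite_residues m : (0 < m)%N ->
  exists E : seq A, forall y, exists a z, a \in E /\ y = a + z *+ m.
Proof.
case: m => // m _.
exists [seq nat_comb s n (fun i => if insub i is Some j then g j else 0%N)
       | g : {ffun 'I_n -> 'I_m.+1}] => y; have [k ->] := gs y.
pose g : {ffun 'I_n -> 'I_m.+1} := [ffun i : 'I_n => inord (k i %% m.+1)].
eexists; exists (nat_comb s n (fun i => k i %/ m.+1)%N).
split; first by apply: image_f; exact: (isT : g \in predT).
rewrite /nat_comb -sumrMnl -big_split; apply: eq_bigr => i _ /=.
by rewrite valK ffunE inordK ?ltn_mod // -mulrnA -mulrnDr addnC -divn_eq.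
Qed.

(** When an integer [m > 0] lies in the annihilator of [b], the residues of
    [A] modulo [m] represent all the classes. It is enough to require that their
    images represent all classes in [B], and that those outside the annihilator
    of [b] remain outside that of [f b]. *)
Lemma finite_step W bs b m : prime_ideal (colon bs b) -> (0 < m)%N ->
  colon bs b m%:R -> exists S, is_step W bs b S.
Proof.
move=> Pprime m0 Pm; have [[sP PM] _ _] := Pprime.
have [E Eres] := finite_residues m0.
have EP y : exists a, a \in E /\ colon bs b (y - a).
  have [a [z [aE ->]]] := Eres y; exists a; split=> //.
  by rewrite addrC addKr -mulr_natr; apply: PM.
pose E' := [seq a <- E | ~~ `[< colon bs b a >]].
exists (fun (B : comPzRingType) (f : A -> B) =>
  (forall y : B, exists a, a \in E /\ colon (map f bs) (f b) (y - f a)) /\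
  (forall a, a \in E' -> ~ colon (map f bs) (f b) (f a))).
split.
- apply def_and.
    apply def_all; apply def_ex_in => a _; apply: (def_colon gs).
    exact: (def_sub gs (var0 _) (def_const gs _ a)).
  apply def_all_in => a _; apply def_not; apply: (def_colon gs).
  exact: (def_const gs _ a).
- rewrite map_id; split; first exact: EP.
  by move=> a; rewrite mem_filter => /andP[/asboolPn].
- move=> B f _ _ [surj inj]; split=> [c|c Pfc].
    by have [a [_ Pa]] := surj c; exists a.
  have [a [aE Pca]] := EP c; apply: contrapT => nPc.
  have [PBs _] := colon_ideal (map f bs) (f b).
  apply: (inj a); last first.
    rewrite -[f a](subKr (f c)) -rmorphB; apply: PBs.2 => //.
    exact: colon_rmorph.
  rewrite mem_filter aE andbT; apply/asboolPn => Pa; apply: nPc.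
  by rewrite -(subrK a c); apply: subgroupD.
Qed.

(** The requirements on [f b] are that its annihilator be prime, that [2] be
    neither zero nor invertible modulo it, so that the quotient has
    characteristic zero, and that every element be a combination of the images
    of the generators of [A] with definable natural coefficients. No element
    [c] outside the annihilator of [b] can be mapped into that of [f b], since
    it has a multiple congruent to a nonzero integer. *)
Lemma infinite_step W bs b : prime_ideal (colon bs b) -> covered_mod2 W ->
  (forall m, (0 < m)%N -> ~ colon bs b m%:R) -> exists S, is_step W bs b S.
Proof.
move=> Pprime cW char0; have [PI P1 PP] := Pprime.
pose PB (B : comPzRingType) (f : A -> B) := colon (map f bs) (f b).
have dPB : @def_pred A n s PB by exact: def_colon.
exists (fun (B : comPzRingType) (f : A -> B) =>
  (~ PB B f 1 /\ forall x y, PB B f (x * y) -> PB B f x \/ PB B f y) /\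
  ((~ PB B f 2%:R /\ forall z, ~ PB B f (2%:R * z - 1)) /\
   forall y, nat_span_mod (PB B f) (size W) (map f (mkseq s n)) y)).
split.
- apply def_and.
    apply def_and; first by apply def_not; apply: dPB; apply: def_one.
    apply def_all; apply def_all; apply def_imp.
      by apply: dPB; apply: def_mul; [exact: var1 | exact: var0].
    by apply def_or; apply: dPB; [exact: var1 | exact: var0].
  apply def_and; last by apply def_all; apply: (def_nat_span_mod gs _ dPB); exact: var0.
  apply def_and; first by apply def_not; apply: dPB; apply: def_natr.
  apply def_all; apply def_not; apply: dPB; apply: (def_sub gs _ (def_one _ _ _)).
  exact: (def_mul (def_natr _ _ _ _) (var0 _)).
- rewrite /PB !map_id; split=> //; split.
    by split=> [|z]; [exact: char0 | exact: (two_nonunit_mod FA Pprime)].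
  move=> y; apply: nat_span_mod_comb => // m.
  apply/(nat_mod_prime FA Pprime _ char0 cW); exists m; rewrite subrr.
  exact: PI.1.1.
- move=> B f FB cfW [[PB1 PBP] [[PB2 PBu] span]].
  have PBI : is_ideal (PB B f) by exact: colon_ideal.
  have PBprime : prime_ideal (PB B f) by split.
  have char0B := char0_mod PBprime PB2 PBu.
  split=> c.
    apply: (nat_span_mod_image PBI _ (span c)) => z.
    by rewrite -(size_map f) => /(nat_mod_prime FB PBprime _ char0B cfW).
  move=> Pfc; apply: contrapT => /(prime_int_multiple FA Pprime)[a [m [cam nPm]]].
  have m0 : m != 0 by apply: contra_not_neq nPm => ->; exact: PI.1.1.
  have PBm : PB B f m%:~R.
    rewrite -(subKr (f c * f a) m%:~R); apply: PBI.1.2.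
      by rewrite mulrC; apply: PBI.2.
    by rewrite -rmorphM -(rmorph_int f) -rmorphB; apply: colon_rmorph.
  apply: (char0B `|m|%N); first by rewrite absz_gt0.
  case: m m0 PBm {cam nPm} => [k|k] _ //.
  by rewrite NegzE mulrNz => /(subgroupN PBI.1); rewrite opprK.
Qed.

Lemma prime_chain_definable W bs : covered_mod2 W -> prime_chain bs ->
  exists Q : forall B : comPzRingType, (A -> B) -> Prop,
    [/\ @def_form A n s 0 (fun B f _ => Q B f), Q A idfun &
        forall (B : comPzRingType) (f : {rmorphism A -> B}),
          FDZ B -> covered_mod2 (map f W) -> Q B f -> chain_controlled f bs].
Proof.
move=> cW; elim: bs => [|b bs IH] /=.
  by exists (fun B f => True); split=> //; exact: def_true.
case=> Pb /IH[Q [dQ QA QP]].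
have [S [dS SA SP]] : exists S, is_step W bs b S.
  have [[m [m0 Pm]]|char0] := pselect (exists m, (0 < m)%N /\ colon bs b m%:R).
    exact: finite_step Pb m0 Pm.
  by apply: infinite_step => // m m0 Pm; apply: char0; exists m.
exists (fun B f => S B f /\ Q B f); split=> //; first exact: def_and.
by move=> B f FB cfW [SB QB]; split; [exact: SP | exact: QP].
Qed.
End Main.

(** * The sentence that characterizes a ring *)

Lemma models_iso (A B : pzRingType) (f : {rmorphism A -> B}) phi :
  bijective f -> models A phi -> models B phi.
Proof.
move=> bf mA e; have [g gK hK] := bf.
apply: (L1_holds_eq (e := f \o (g \o e)) _).1 => [i _ /=|]; first exact: hK.
by apply/(L1_holds_iso _ _ bf); apply: mA.
Qed.

Theorem corollary1p2 :
  forall A : comPzRingType, FDZ A ->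
    exists psi : L1_formula,
      L1_sentence psi /\ models A psi /\
      forall B : comPzRingType, FDZ B -> (models B psi <-> ring_iso A B).
Proof.
move=> A FA; have [n [s gs]] := FDZ_nat_generates FA.
have [W WP] := finite_residues gs (m := 2) isT.
have cW : covered_mod2 W by move=> y; have [w [z [wW ->]]] := WP y; exists w, z.
have [bs [cbs I1]] := prime_filtration FA.
have [Q [dQ QA QP]] := prime_chain_definable FA gs cW cbs.
pose cover (B : comPzRingType) (f : A -> B) :=
  forall y, exists a, a \in W /\ exists z, y = f a + (z + z).
have coverP (B : comPzRingType) (f : A -> B) : cover B f -> covered_mod2 (map f W).
  by move=> cf y; have [a [aW [z ->]]] := cf y; exists (f a), z; rewrite map_f.
have [|psi [psi0 psiP]] := @sentence_of_def A n s gs (fun B f => cover B f /\ Q B f).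
  apply def_and => //; apply def_all; apply def_ex_in => a _; apply def_ex.
  apply: def_eq; first exact: (def_lift (def_var _ _ _)).
  exact: (def_add (def_const gs _ a) (def_add (def_var _ _ _) (def_var _ _ _))).
have mA : models A psi.
  apply/psiP; exists idfun; split=> // y.
  by have [w [z [wW ->]]] := cW y; exists w; split=> //; exists z.
exists psi; split=> //; split=> // B FB; split=> [/psiP[f [cf Qf]]|[f bf]].
  exists f; apply: controlled_bijective I1.
  by apply: QP => //; apply: coverP.
exact: models_iso bf mA.
Qed.
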